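(* Let $X$ be a normed linear space, $Y$ a Banach space, and $k\in\mathbb N\cup\{\infty\}$ such that the pair $(X,Y)$ has properties (LE) and (LA$_k$). Let $U\subset X$ be an open set with property (WQ), let $f\in C^1(U;Y)$, and suppose that the mapping $Df\colon U\to\mathcal L(X;Y)$ has a continuous extension $G\colon\overline U\to\mathcal L(X;Y)$. Then $f$ can be extended to a mapping $g\in C^1(X;Y)$ such that $g$ is $C^k$-smooth on $X\setminus\overline U$.
   Context: All normed linear spaces are real. $U(x,r)$ is the open ball with centre $x$ and radius $r$, $U_X$ is the open unit ball of $X$. An $L$-Lipschitz mapping is a mapping with a (not necessarily minimal) Lipschitz constant $L$. $\mathcal L(X;Y)$ is the normed space of continuous linear operators from $X$ to $Y$. $Df$ is the Fréchet derivative. For open $\Omega\subset X$, $C^k(\Omega;Y)$ is the space of $C^k$-smooth (in the Fréchet sense) mappings from $\Omega$ to $Y$. Property (WQ): a subset $U$ of a metric space $(X,\rho)$ has property (WQ) if for each $a\in\partial U$ there exist $r>0$ and $c\ge1$ such that for each $x,y\in U\cap U(a,r)$ there exists a continuous rectifiable curve $\gamma\colon[0,1]\to U$ such that $\gamma(0)=x$, $\gamma(1)=y$, and $\operatorname{len}\gamma\le c\rho(x,y)$, where $\operatorname{len}\gamma$ is the length of $\gamma$. Property (LE): the pair $(X,Y)$ of normed linear spaces has property (LE) if there is $C>0$ such that for every $A\subset X$ every $L$-Lipschitz mapping $f\colon A\to Y$ has a $CL$-Lipschitz extension to the whole of $X$. Property (LA$_k$), $k\in\mathbb N\cup\{\infty\}$: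 the pair $(X,Y)$ of normed linear spaces has property (LA$_k$) if there is $C\ge0$ such that for any $L$-Lipschitz mapping $f\colon U_X\to Y$ and any $\varepsilon>0$ there is a $CL$-Lipschitz mapping $g\in C^k(U_X;Y)$ such that $\sup_{U_X}\|f-g\|\le\varepsilon$. *)

(* Defs.v *)
From HB Require Import structures.
From mathcomp Require Import all_boot all_order all_algebra.
From mathcomp Require Import all_classical all_reals all_analysis.

Set Implicit Arguments.
Unset Strict Implicit.
Unset Printing Implicit Defensive.

Import Order.TTheory GRing.Theory Num.Theory.
Import numFieldNormedType.Exports.

Local Open Scope classical_set_scope.
Local Open Scope ring_scope.

Section bounded_operators.
Context {R : realType} {X Y : normedModType R}.

Definition bounded_op : {pred X -> Y} :=
  [pred f | `[< linear f /\ continuous f >]].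

Record boundedOp := BoundedOp { bo_fun :> X -> Y ; _ : bo_fun \in bounded_op }.

HB.instance Definition _ := [isSub for bo_fun].
HB.instance Definition _ := [Choice of boundedOp by <:].

Lemma bounded_opP (f : X -> Y) :
  reflect (linear f /\ continuous f) (f \in bounded_op).
Proof. exact: asboolP. Qed.

Lemma bo_submod_closed : submod_closed bounded_op.
Proof.
split; first by apply/bounded_opP; split=> [a x y|x] /=;
  [rewrite /= scaler0 addr0 | exact: cvg_cst].
move=> a f g /bounded_opP[fl fc] /bounded_opP[gl gc]; apply/bounded_opP; split.
  move=> b x y; rewrite !fctE fl gl !scalerDr !scalerA (mulrC a b) -!addrA.
  by congr (_ + _); rewrite addrCA.
by move=> x; apply: cvgD (gc x); apply: cvgZl_tmp; exact: fc.
Qed.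

HB.instance Definition _ := GRing.isSubmodClosed.Build _ _ bounded_op
  bo_submod_closed.

HB.instance Definition _ := [SubChoice_isSubLmodule of boundedOp by <:].

Lemma bo_linear (f : boundedOp) : linear f.
Proof. by case: f => f /= /bounded_opP[]. Qed.

HB.instance Definition _ (f : boundedOp) :=
  GRing.isLinear.Build R X Y _ f (bo_linear f).

Lemma bo_continuous (f : boundedOp) : continuous f.
Proof. by case: f => f /= /bounded_opP[]. Qed.

Definition opnorm (f : boundedOp) : R :=
  sup [set `|f x| | x in [set x | `|x| <= 1]].

Lemma opnorm_has_sup (f : boundedOp) :
  has_sup [set `|f x| | x in [set x | `|x| <= 1]].
Proof.
split; first by exists `|f 0|, 0 => //=; rewrite normr0 ler01.
have /linear_boundedP : bounded_near f (nbhs 0).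
  exact/linear_bounded_continuous/bo_continuous.
move=> /pinfty_ex_gt0[M M0 Mf]; exists M => _ [x x1 <-].
by rewrite (le_trans (Mf x))// ler_piMr// ltW.
Qed.

Lemma opnorm_ge0 (f : boundedOp) : 0 <= opnorm f.
Proof.
apply: (ub_le_sup (proj2 (opnorm_has_sup f))).
by exists 0 => //=; rewrite ?normr0 ?ler01// linear0 normr0.
Qed.

Lemma opnorm_ub (f : boundedOp) (x : X) : `|f x| <= opnorm f * `|x|.
Proof.
have [->|x0] := eqVneq x 0; first by rewrite linear0 !normr0 mulr0.
rewrite -ler_pdivrMr ?normr_gt0//.
suff -> : `|f x| / `|x| = `|f (`|x|^-1 *: x)|.
  apply: (ub_le_sup (proj2 (opnorm_has_sup f))).
  by exists (`|x|^-1 *: x) => //=; rewrite normfZV.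
by rewrite linearZ/= normrZ normfV normr_id mulrC.
Qed.

Lemma opnorm_le (f : boundedOp) (M : R) :
  (forall x, `|x| <= 1 -> `|f x| <= M) -> opnorm f <= M.
Proof.
move=> fM; apply: ge_sup; first exact: (proj1 (opnorm_has_sup f)).
by move=> _ [x x1 <-]; exact: fM.
Qed.

Lemma opnormD (f g : boundedOp) : opnorm (f + g) <= opnorm f + opnorm g.
Proof.
apply: opnorm_le => x x1; rewrite (le_trans (ler_normD _ _))// lerD//.
  by rewrite (le_trans (opnorm_ub f x))// ler_piMr// opnorm_ge0.
by rewrite (le_trans (opnorm_ub g x))// ler_piMr// opnorm_ge0.
Qed.

Lemma opnormZ_le (l : R) (f : boundedOp) : opnorm (l *: f) <= `|l| * opnorm f.
Proof.
apply: opnorm_le => x x1; rewrite [leLHS](normrZ l (f x)) ler_wpM2l//.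
by rewrite (le_trans (opnorm_ub f x))// ler_piMr// opnorm_ge0.
Qed.

Lemma opnorm0_eq0 (f : boundedOp) : opnorm f = 0 -> f = 0.
Proof.
move=> f0; apply/val_inj/funext => x /=.
by apply/eqP; rewrite -normr_le0 (le_trans (opnorm_ub f x))// f0 mul0r.
Qed.

Lemma opnormZ (l : R) (f : boundedOp) : opnorm (l *: f) = `|l| * opnorm f.
Proof.
apply/eqP; rewrite eq_le opnormZ_le/=.
have [->|l0] := eqVneq l 0; first by rewrite normr0 mul0r opnorm_ge0.
rewrite -ler_pdivlMl ?normr_gt0// -normfV.
by rewrite -[in leLHS](scalerK l0 f) opnormZ_le.
Qed.

HB.instance Definition _ :=
  Lmodule_isNormed.Build R boundedOp opnormD opnormZ opnorm0_eq0.

End bounded_operators.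
Arguments boundedOp {R} X Y.
Notation "''L' ( X ; Y )" := (boundedOp X Y)
  (at level 0, X, Y at level 99, format "''L' ( X ;  Y )") : type_scope.

Section smoothness.
Context {R : realType} {X : normedModType R}.
Implicit Type Y : normedModType R.

(* The map Omega -> Y is given by a total function f; for open Omega the
   predicate only depends on the values of f on Omega. Class C^{n.+1} means
   that the Frechet derivative D : Omega -> L(X; Y) exists and is C^n for the
   operator norm. *)
Fixpoint Cn (n : nat) Y (Omega : set X) (f : X -> Y) : Prop :=
  match n with
  | 0 => {within Omega, continuous f}
  | n'.+1 => exists D : X -> 'L(X; Y),
      (forall x, Omega x -> is_diff x f (D x)) /\ Cn n' Omega D
  end.

(* [Some n] stands for the order n and [None] for the order infinity. *)
Definition Ck (k : option nat) Y (Omega : set X) (f : X -> Y) : Prop :=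
  if k is Some n then Cn n Omega f else forall n, Cn n Omega f.

End smoothness.

Section properties.
Context {R : realType}.
Implicit Types X Y : normedModType R.

Definition boundary (T : topologicalType) (A : set T) : set T :=
  closure A `\` interior A.

(* For a partition t_0 = a < t_1 < ... < t_n = b, encoded as the list
   [t_1; ...; t_n], the sum of the |g t_{i+1} - g t_i|. *)
Definition polygon_length X (a b : R) (g : R -> X) (s : seq R) : R :=
  let G := g \o nth b (a :: s) in
  \sum_(0 <= n < size s) `|G n.+1 - G n|.

Definition curve_length X (a b : R) (g : R -> X) : \bar R :=
  ereal_sup [set (polygon_length a b g s)%:E | s in itv_partition a b].

Definition rectifiable X (a b : R) (g : R -> X) : Prop :=
  (curve_length a b g < +oo)%E.

Definition WQ X (U : set X) : Prop :=
  forall a, boundary U a ->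
  exists r c : R, [/\ 0 < r, 1 <= c &
    forall x y, (U `&` ball a r) x -> (U `&` ball a r) y ->
    exists g : R -> X,
      [/\ {within `[0, 1], continuous g},
          (forall t, t \in `[0, 1] -> U (g t)),
          g 0 = x /\ g 1 = y,
          rectifiable 0 1 g &
          (curve_length 0 1 g <= (c * `|x - y|)%:E)%E]].

(* A map A -> Y is given by a total function constrained on A only. The
   condition 0 <= L matters: a map on a singleton satisfies the Lipschitz
   inequality for every L, negative ones included. *)
Definition LE X Y : Prop :=
  exists2 C : R, 0 < C &
    forall (A : set X) (L : R) (f : X -> Y), 0 <= L -> L.-lipschitz_A f ->
    exists2 g : X -> Y, (C * L).-lipschitz g & forall x, A x -> g x = f x.

Definition open_unit_ball X : set X := ball 0 1.
Arguments open_unit_ball : clear implicits.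

Definition LA (k : option nat) X Y : Prop :=
  exists2 C : R, 0 <= C &
    forall (L : R) (f : X -> Y), 0 <= L -> L.-lipschitz_(open_unit_ball X) f ->
    forall eps : R, 0 < eps ->
    exists g : X -> Y,
      [/\ (C * L).-lipschitz_(open_unit_ball X) g,
          Ck k (open_unit_ball X) g &
          (ereal_sup [set `|f x - g x|%:E | x in open_unit_ball X]
             <= eps%:E)%E].

End properties.

(* Main.v *)
(* Property (WQ) and the continuity of G make f a Whitney jet on F = closure U:
   near every a in F the map f - G(a) has an arbitrarily small Lipschitz
   constant on F. Local Lipschitz extensions of f - G(a), smoothed by (LA_k) and
   glued by a sigma-discrete C^k partition of unity, give a C^1 map g_n on X. The
   smoothing errors are chosen after the partition, so they can be taken so small
   that f - g_n is globally 2^-n-Lipschitz (up to a constant) on F; then (LE)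
   applies to f - g_n and yields an extension p_n of f which is 2^-n-close to
   G(b) in the Lipschitz sense near every b in F. The p_n are interpolated
   off F by cutoffs depending on the ratio of a local scale to the distance d to
   F: their Lipschitz constants are O(1/d), whereas p_(n+1) - p_n vanishes on F
   and hence is O(2^-n d). The resulting map is strictly differentiable at the
   points of F, and smoothing it once more on X \ F, with errors O(d^2), gives g. *)

(* A map obtained from (LE) has no derivative to work with, so the estimates concern Lipschitz
   constants of [h - T] near a point, for operators [T]. Such a constant bounds the distance from
   [T] to the derivative as soon as the latter exists ([slope_near_diff]); this is what finally
   controls [Dg]. The weights of the partition have uncontrolled Lipschitz constants. They do no
   harm: the n-th of them multiplies only the n-th smoothing error, which makes a summable
   contribution, while the local Lipschitz constants are averaged by weights of sum at most 1. Hence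
   the factor 3 + C of [smoothing] does not depend on the partition. A single p_n leaves a slope
   error of order 2^-n at F, and the radius on which p_n is good varies with the point without
   uniformity. The supremum of cones [scale] turns these radii into a 1-Lipschitz function from
   which cutoffs can be built. Partitions of unity require (LA_k) with real values; it is derived
   from the pair (X, Y) by a functional on Y. Completeness of Y serves to extend f to the closure,
   and (WQ) gives the mean value inequality along short curves near the boundary. *)
From HB Require Import structures.
Require Import Defs.
From mathcomp Require Import all_boot all_order all_algebra.
From mathcomp Require Import all_classical all_reals all_analysis.
From mathcomp Require Import wochoice ring lra.
Set Implicit Arguments.
Unset Strict Implicit.
Unset Printing Implicit Defensive.
Import Order.TTheory GRing.Theory Num.Theory.
Import numFieldNormedType.Exports.
Local Open Scope classical_set_scope.
Local Open Scope ring_scope.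

(* Linear identities in a module are decided by comparing, with [ring], the
   coefficients of every atom on both sides. *)
Inductive lmod_expr (R : Type) :=
| LVar of nat | LZero | LAdd of lmod_expr R & lmod_expr R
| LOpp of lmod_expr R | LScale of R & lmod_expr R.

Section lmod_reflection.
Context {R : comNzRingType} {V : lmodType R}.

Fixpoint leval (l : seq V) (e : lmod_expr R) : V :=
  match e with
  | LVar i => nth 0 l i
  | LZero => 0
  | LAdd a b => leval l a + leval l b
  | LOpp a => - leval l a
  | LScale c a => c *: leval l a
  end.

(** [Nat.eqb] rather than [==], so that [cbn] computes the coefficients inside the tactic [lmod]. *)
Fixpoint lcoef (i : nat) (e : lmod_expr R) : R :=
  match e with
  | LVar j => if Nat.eqb i j then 1 else 0
  | LZero => 0
  | LAdd a b => lcoef i a + lcoef i b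
  | LOpp a => - lcoef i a
  | LScale c a => c * lcoef i a
  end.

Fixpoint lcoef_eq (n : nat) (e f : lmod_expr R) : Prop :=
  if n is m.+1 then lcoef m e = lcoef m f /\ lcoef_eq m e f else True.

Lemma levalE (l : seq V) e :
  leval l e = \sum_(i < size l) lcoef i e *: nth 0 l i.
Proof.
elim: e => /= [j| |a -> b ->|a ->|c a ->].
- have [jl|jl] := ltnP j (size l); last first.
    rewrite nth_default// big1// => i _.
    by case: PeanoNat.Nat.eqb_spec => [ij|_]; [move: (ltn_ord i); rewrite ij ltnNge jl|
      rewrite scale0r].
  rewrite (bigD1 (Ordinal jl))//= PeanoNat.Nat.eqb_refl scale1r big1 ?addr0// => i.
  case: PeanoNat.Nat.eqb_spec => [ij|_ _]; last by rewrite scale0r.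
  by move/negP; case; apply/eqP/val_inj.
- by rewrite big1// => i _; rewrite scale0r.
- by rewrite -big_split; apply: eq_bigr => i _; rewrite scalerDl.
- by rewrite -sumrN; apply: eq_bigr => i _; rewrite scaleNr.
- by rewrite scaler_sumr; apply: eq_bigr => i _; rewrite scalerA.
Qed.

Lemma leval_eq (l : seq V) e f : lcoef_eq (size l) e f -> leval l e = leval l f.
Proof.
move=> ef; rewrite !levalE; apply: eq_bigr => i _; congr (_ *: _).
elim: (size l) (nat_of_ord i) (ltn_ord i) ef => [//|n IH] j.
by rewrite ltnS leq_eqVlt => /predU1P[->|jn] /= [] // _; exact: IH.
Qed.
End lmod_reflection.

Ltac lmod_mem x l :=
  match l with
  | cons x _ => constr:(true)
  | cons _ ?t => lmod_mem x t
  | _ => constr:(false)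
  end.
Ltac lmod_index x l :=
  match l with
  | cons x _ => constr:(0%N)
  | cons _ ?t => let i := lmod_index x t in constr:(S i)
  end.
Ltac lmod_atoms t l :=
  match t with
  | (?a + ?b)%R => let l := lmod_atoms a l in lmod_atoms b l
  | (- ?a)%R => lmod_atoms a l
  | (_ *: ?a)%R => lmod_atoms a l
  | 0%R => l
  | _ => match lmod_mem t l with true => l | _ => constr:(cons t l) end
  end.
Ltac lmod_reify R l t :=
  match t with
  | (?a + ?b)%R => let a := lmod_reify R l a in let b := lmod_reify R l b in
                   constr:(@LAdd R a b)
  | (- ?a)%R => let a := lmod_reify R l a in constr:(@LOpp R a)
  | (?c *: ?a)%R => let a := lmod_reify R l a in constr:(@LScale R c a)
  | 0%R => constr:(@LZero R)
  | _ => let i := lmod_index t l in constr:(@LVar R i)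
  end.
Ltac lmod R :=
  match goal with
  | |- @eq ?V ?a ?b =>
    let l := lmod_atoms a (@nil V) in
    let l := lmod_atoms b l in
    let ea := lmod_reify (R : Type) l a in
    let eb := lmod_reify (R : Type) l b in
    apply: (@leval_eq R _ l ea eb);
    cbn [lcoef_eq lcoef size Nat.eqb]; repeat split; try ring
  end.

(** * Bounded operators and differentials *)

Section differentials.
Context {R : realType}.
Implicit Types X Y Z : normedModType R.

Lemma nbhsNP X (x : X) (P : set X) :
  nbhs x P <-> exists2 d : R, 0 < d & forall y, `|y - x| < d -> P y.
Proof.
split=> [/nbhs_normP[d /= d0 dP]|[d d0 dP]].
  by exists d => // y yx; apply: dP; rewrite /= distrC.
by apply/nbhs_normP; exists d => //= y /=; rewrite distrC; exact: dP.
Qed.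

(** Differentials are handled through this epsilon-delta form from here on. For the converse,
    [diff_unique] identifies the differential with [L], whose continuity is part of its type. *)
Lemma is_diffP X Y (f : X -> Y) (x : X) (L : 'L(X; Y)) :
  is_diff x f L <-> forall e : R, 0 < e -> exists2 d : R, 0 < d &
    forall y, `|y - x| < d -> `|f y - f x - L (y - x)| <= e * `|y - x|.
Proof.
split=> [[fx dfx] e e0|fL].
  have /diff_locally/eqaddoP/(_ e e0) := fx.
  rewrite dfx => /nbhsNP[d d0 dP]; exists d => // y yx.
  have := dP (y - x); rewrite /= subr0 => /(_ yx).
  rewrite -[X in `|X| <= _ -> _]/(f (y - x + x) - (f x + L (y - x))).
  by rewrite subrK opprD addrA.
have H : f \o shift x = cst (f x) + (L : X -> Y) +o_ 0 id.
  apply/eqaddoP => e e0; have [d d0 dP] := fL e e0.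
  apply/nbhsNP; exists d => // y; rewrite subr0 => yd.
  have := dP (y + x); rewrite addrK => /(_ yd).
  by rewrite -[X in _ -> `|X| <= _]/(f (y + x) - (f x + L y)) opprD addrA.
have dL : 'd f x = L :> (X -> Y) by apply: diff_unique => //; exact: bo_continuous.
split=> //; apply/diff_locallyP; rewrite dL; split=> //.
exact: bo_continuous.
Qed.

Lemma is_diff_unique X Y (f : X -> Y) (x : X) (L M : 'L(X; Y)) :
  is_diff x f L -> is_diff x f M -> L = M.
Proof. by move=> [_ dL] [_ dM]; apply/val_inj; rewrite /= -dL -dM. Qed.

Lemma is_diff_near X Y (f g : X -> Y) (x : X) (L : 'L(X; Y)) :
  (\forall y \near x, f y = g y) -> is_diff x f L -> is_diff x g L.
Proof.
move=> /nbhsNP[r r0 fg] /is_diffP fL; apply/is_diffP => e e0.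
have [d d0 dP] := fL e e0; exists (Num.min d r); first by rewrite lt_min d0.
by move=> y; rewrite lt_min => /andP[yd yr]; rewrite -!fg// ?subrr ?normr0// dP.
Qed.

Definition bo_mk X Y (f : X -> Y) (fl : linear f) (fc : continuous f) : 'L(X; Y) :=
  BoundedOp (introT (bounded_opP f) (conj fl fc)).

Lemma bounded_continuous X Y (f : X -> Y) (M : R) : linear f ->
  (forall x, `|f x| <= M * `|x|) -> continuous f.
Proof.
move=> fl fM.
pose g : {linear X -> Y} := HB.pack f (GRing.isLinear.Build R X Y _ f fl).
have : continuous g; last by [].
rewrite -linear_bounded_continuous.
apply/linear_boundedP; exists `|M|; split; first by rewrite realE normr_ge0.
move=> r Mr x; rewrite (le_trans (fM x))// ler_wpM2r// (le_trans (ler_norm _))//.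
exact: ltW.
Qed.

Definition bo_of X Y (f : X -> Y) (M : R) (fl : linear f)
  (fM : forall x, `|f x| <= M * `|x|) : 'L(X; Y) :=
  bo_mk fl (bounded_continuous fl fM).

Lemma bo_of_norm X Y (f : X -> Y) (M : R) (fl : linear f)
  (fM : forall x, `|f x| <= M * `|x|) : 0 <= M -> `|bo_of fl fM| <= M.
Proof.
move=> M0; apply: opnorm_le => x x1 /=.
by rewrite (le_trans (fM x))// ler_piMr.
Qed.

Lemma bo_le X Y (L : 'L(X; Y)) (M : R) : 0 <= M ->
  (forall x, `|L x| <= M * `|x|) -> `|L| <= M.
Proof.
move=> M0 LM; apply: opnorm_le => x x1.
by rewrite (le_trans (LM x))// ler_piMr.
Qed.

Lemma boDE X Y (L M : 'L(X; Y)) x : (L + M) x = L x + M x.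
Proof. by []. Qed.
Lemma boNE X Y (L : 'L(X; Y)) x : (- L) x = - L x.
Proof. by []. Qed.
Lemma boBE X Y (L M : 'L(X; Y)) x : (L - M) x = L x - M x.
Proof. by []. Qed.
Lemma boZE X Y a (L : 'L(X; Y)) x : (a *: L) x = a *: L x.
Proof. by []. Qed.
Lemma bo0E X Y x : (0 : 'L(X; Y)) x = 0.
Proof. by []. Qed.

End differentials.

(** * Calculus of C^n maps *)

Section Cn_calculus.
Context {R : realType} {X : normedModType R}.
Implicit Types (Y Z : normedModType R) (Om : set X).

Lemma open_ballN Om (x : X) : open Om -> Om x ->
  exists2 r : R, 0 < r & forall y, `|y - x| < r -> Om y.
Proof. by move=> oO Ox; apply/nbhsNP; apply: open_nbhs_nbhs. Qed.

Lemma Cn0P Y Om (f : X -> Y) : open Om ->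
  Cn 0 Om f <-> forall x, Om x -> forall e : R, 0 < e -> exists2 d : R, 0 < d &
    forall y, `|y - x| < d -> `|f y - f x| < e.
Proof.
move=> oO; rewrite /= continuous_open_subspace//; split => [fc x Ox e e0|H].
  apply/nbhsNP.
  have /cvgrPdist_lt/(_ e e0) := fc x (mem_set Ox).
  by apply: filterS => y; rewrite distrC.
move=> x /set_mem Ox.
apply/cvgrPdist_lt => e e0; apply/nbhsNP.
have [d d0 dP] := H x Ox e e0; exists d => // y /dP.
by rewrite distrC.
Qed.

Lemma CnW n Y Om Om' (f : X -> Y) : Om' `<=` Om -> Cn n Om f -> Cn n Om' f.
Proof.
move=> OO; elim: n Y f => [|n IH] Y f /=; first exact: continuous_subspaceW.
by move=> [D [Df /IH CD]]; exists D; split=> // x /OO /Df.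
Qed.

Lemma is_diff_cont Y (f : X -> Y) x (L : 'L(X; Y)) : is_diff x f L ->
  forall e : R, 0 < e -> exists2 d : R, 0 < d &
    forall y, `|y - x| < d -> `|f y - f x| < e.
Proof.
move=> [fx _] e e0; apply/nbhsNP.
have /differentiable_continuous/cvgrPdist_lt/(_ e e0) := fx.
by apply: filterS => y; rewrite distrC.
Qed.

Lemma Cn_pred n Y Om (f : X -> Y) : open Om -> Cn n.+1 Om f -> Cn n Om f.
Proof.
move=> oO; elim: n Y f => [|n IH] Y f [D [Df CD]]; last first.
  by exists D; split => //; apply: IH.
by apply/Cn0P => // x /Df; exact: is_diff_cont.
Qed.

Lemma open_bN (x : X) (r : R) : open [set y | `|y - x| < r].
Proof.
rewrite (_ : [set _ | _] = ball x r); first exact: ball_open.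
by apply/seteqP; split=> y; rewrite -ball_normE /= distrC.
Qed.

Lemma Cn_local n Y Om (f : X -> Y) : open Om ->
  (forall x, Om x -> exists r : R, exists g : X -> Y,
    [/\ 0 < r, Cn n [set y | `|y - x| < r] g &
        forall y, `|y - x| < r -> f y = g y]) ->
  Cn n Om f.
Proof.
move=> oO; elim: n Y f => [|n IH] Y f H.
  apply/Cn0P => // x Ox e e0; have [r [g [r0 /Cn0P Cg fg]]] := H x Ox.
  have [|d d0 dP] := Cg (open_bN x r) x _ e e0; first by rewrite /= subrr normr0.
  exists (Num.min d r); first by rewrite lt_min d0.
  by move=> y; rewrite lt_min => /andP[yd yr]; rewrite !fg ?subrr ?normr0// dP.
have key (x : X) (r : R) (g : X -> Y) (D : X -> 'L(X; Y)) : 0 < r ->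
    (forall y, `|y - x| < r -> is_diff y g (D y)) ->
    (forall y, `|y - x| < r -> f y = g y) ->
    forall y, `|y - x| < r -> is_diff y f (D y).
  move=> r0 dg fg y yr; apply: is_diff_near (dg _ yr).
  have [d d0 dP] := open_ballN (open_bN x r) yr.
  by apply/nbhsNP; exists d => // z /dP /= /fg.
(* The differential is chosen wherever one exists. By uniqueness it coincides near each point with
   the local [D], so the induction hypothesis applies to it. *)
exists (fun x => xget (0 : 'L(X; Y)) [set L : 'L(X; Y) | is_diff x f L]); split.
  move=> x Ox; have [r [g [r0 [D [dg _]] fg]]] := H x Ox.
  have xr : `|x - x| < r by rewrite subrr normr0.
  by case: xgetP => // /(_ (D x)); case; apply: (key x r g D r0).
apply: IH => x Ox; have [r [g [r0 [D [dg CD]] fg]]] := H x Ox.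
exists r, D; split => // y yr.
have dfy := key x r g D r0 dg fg y yr.
by case: xgetP => [M _ dM|/(_ (D y))//]; exact: is_diff_unique dM dfy.
Qed.

Lemma Cn_eq n Y Om (f g : X -> Y) : open Om ->
  (forall x, Om x -> f x = g x) -> Cn n Om g -> Cn n Om f.
Proof.
move=> oO fg Cg; apply: Cn_local => // x Ox.
have [r r0 rP] := open_ballN oO Ox.
by exists r, g; split=> //; [apply: CnW Cg => y /rP|move=> y /rP /fg].
Qed.

Lemma Cn_cst n Y Om (c : Y) : open Om -> Cn n Om (fun=> c).
Proof.
move=> oO; elim: n Y c => [|n IH] Y c.
  by apply/Cn0P => // x _ e e0; exists 1 => // y _; rewrite subrr normr0.
exists (fun=> 0); split=> // x Ox; apply/is_diffP => e e0.
by exists 1 => // y _; rewrite subrr bo0E subr0 normr0 mulr_ge0// ltW.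
Qed.

Lemma Cn_lin n Y Om (T : 'L(X; Y)) : open Om -> Cn n Om T.
Proof.
case: n => [|n] oO.
  by apply: continuous_subspaceT => x; exact: bo_continuous.
exists (fun=> T); split; last exact: Cn_cst.
move=> x Ox; apply/is_diffP => e e0; exists 1 => // y _.
by rewrite linearB/= subrr normr0 mulr_ge0// ltW.
Qed.

Lemma is_diff_add Y (f g : X -> Y) x (L M : 'L(X; Y)) :
  is_diff x f L -> is_diff x g M -> is_diff x (fun y => f y + g y) (L + M).
Proof.
move=> /is_diffP fL /is_diffP gM; apply/is_diffP => e e0.
have [d d0 dP] := fL (e / 2) (divr_gt0 e0 (ltr0n _ 2)).
have [c c0 cP] := gM (e / 2) (divr_gt0 e0 (ltr0n _ 2)).
exists (Num.min d c); first by rewrite lt_min d0.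
move=> y; rewrite lt_min => /andP[yd yc].
rewrite boDE.
have -> : f y + g y - (f x + g x) - (L (y - x) + M (y - x)) =
  (f y - f x - L (y - x)) + (g y - g x - M (y - x)) by lmod R.
rewrite (le_trans (ler_normD _ _))//.
by rewrite [in leRHS](splitr e) mulrDl lerD ?dP ?cP.
Qed.
End Cn_calculus.

(** * Products through bounded bilinear maps *)

Section Cn_bilinear.
Context {R : realType} {X : normedModType R}.
Implicit Types (Y Z : normedModType R) (Om : set X).

Record bilin Y1 Y2 Z (B : Y1 -> Y2 -> Z) (M : R) : Prop := Bilin {
  bilin_ge0 : 0 <= M;
  bilin_l : forall z, linear (B^~ z);
  bilin_r : forall y, linear (B y);
  bilin_ub : forall y z, `|B y z| <= M * `|y| * `|z| }.

Lemma bilinC Y1 Y2 Z (B : Y1 -> Y2 -> Z) M :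
  bilin B M -> bilin (fun z y => B y z) M.
Proof. by case=> M0 Bl Br BM; split=> // y z; rewrite mulrAC. Qed.

Lemma bilinBl Y1 Y2 Z (B : Y1 -> Y2 -> Z) M y y' z :
  bilin B M -> B (y - y') z = B y z - B y' z.
Proof.
by move=> hB; rewrite -scaleN1r addrC (bilin_l hB) scaleN1r addrC.
Qed.

Lemma bilinBr Y1 Y2 Z (B : Y1 -> Y2 -> Z) M y z z' :
  bilin B M -> B y (z - z') = B y z - B y z'.
Proof. by move=> hB; exact: (bilinBl z z' y (bilinC hB)). Qed.

Section composition.
Variables (Y1 Y2 Z : normedModType R) (B : Y1 -> Y2 -> Z) (M : R) (hB : bilin B M).

Lemma bo_bil_linear (L : 'L(X; Y1)) (z : Y2) : linear (fun v => B (L v) z).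
Proof. by move=> a u v; rewrite linearP (bilin_l hB). Qed.

Lemma bo_bil_ub (L : 'L(X; Y1)) (z : Y2) v :
  `|B (L v) z| <= M * `|L| * `|z| * `|v|.
Proof.
rewrite (le_trans (bilin_ub hB _ _))// -!mulrA ler_wpM2l ?(bilin_ge0 hB)//.
by rewrite [leLHS]mulrC [leRHS]mulrCA ler_wpM2l// opnorm_ub.
Qed.

Definition bo_bil (L : 'L(X; Y1)) (z : Y2) : 'L(X; Z) :=
  bo_of (bo_bil_linear L z) (bo_bil_ub L z).

Lemma bilin_bo_bil : bilin bo_bil M.
Proof.
split; first exact: bilin_ge0 hB.
- by move=> z a L K; apply/val_inj/funext => v /=; exact: bilin_l hB _ _ _ _.
- by move=> L a z z'; apply/val_inj/funext => v /=; exact: bilin_r hB _ _ _ _.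
- by move=> L z; apply: bo_of_norm; rewrite !mulr_ge0// (bilin_ge0 hB).
Qed.
End composition.

Section product.
Variables (Y1 Y2 Z : normedModType R) (B : Y1 -> Y2 -> Z) (M : R) (hB : bilin B M).

Lemma bilin_diff (f : X -> Y1) (g : X -> Y2) x (L : 'L(X; Y1)) (K : 'L(X; Y2)) :
  is_diff x f L -> is_diff x g K ->
  is_diff x (fun y => B (f y) (g y))
    (bo_bil hB L (g x) + bo_bil (bilinC hB) K (f x)).
Proof.
move=> df dg; have /is_diffP fL := df; have /is_diffP gK := dg.
apply/is_diffP => e e0; have M0 := bilin_ge0 hB.
(* [c - 1] is the total coefficient of [e1] in the final estimate; [e1 <= 1] is what bounds the
   difference quotient of [f] by [|L| + 1]. *)
pose c := M * (`|f x| + `|g x| + `|L| + 1) + 1.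
have c0 : 0 < c by rewrite /c ltr_wpDl// mulr_ge0// !addr_ge0.
pose e1 := Num.min 1 (e / (3 * c)).
have e10 : 0 < e1 by rewrite lt_min ltr01 divr_gt0// mulr_gt0.
have e1c : e1 * c <= e / 3.
  rewrite -ler_pdivlMr// ge_min -[X in _ || (_ <= X)]mulrA -invfM lexx orbT//.
have e11 : e1 <= 1 by rewrite ge_min lexx.
have [d1 d10 fP] := fL e1 e10.
have [d2 d20 gP] := gK e1 e10.
have [d3 d30 gC] := is_diff_cont dg e10.
exists (Num.min d1 (Num.min d2 d3)); first by rewrite !lt_min d10 d20.
move=> y; rewrite !lt_min => /and3P[y1 y2 y3].
rewrite boDE /=.
have -> : B (f y) (g y) - B (f x) (g x) - (B (L (y - x)) (g x) + B (f x) (K (y - x))) =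
   B (f y - f x - L (y - x)) (g x) + B (f x) (g y - g x - K (y - x))
   + B (f y - f x) (g y - g x).
  by rewrite !(bilinBl _ _ _ hB) !(bilinBr _ _ _ hB); lmod R.
have fyx : `|f y - f x| <= (`|L| + 1) * `|y - x|.
  rewrite -[f y - f x](subrK (L (y - x))) (le_trans (ler_normD _ _))// addrC mulrDl.
  rewrite lerD ?opnorm_ub// (le_trans (fP _ y1))// ler_wpM2r//.
have n0 : 0 <= `|y - x| by [].
apply: (@le_trans _ _ (M * (e1 * `|y - x|) * `|g x| + M * `|f x| * (e1 * `|y - x|)
   + M * ((`|L| + 1) * `|y - x|) * e1)).
  rewrite (le_trans (ler_normD _ _))// lerD//.
    rewrite (le_trans (ler_normD _ _))// lerD//.
      rewrite (le_trans (bilin_ub hB _ _))// ler_wpM2r// ler_wpM2l// fP//.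
    by rewrite (le_trans (bilin_ub hB _ _))// ler_wpM2l ?mulr_ge0// gP.
  rewrite (le_trans (bilin_ub hB _ _))// ler_pM ?mulr_ge0//.
    by rewrite ler_wpM2l.
  by rewrite ltW// gC.
have -> : M * (e1 * `|y - x|) * `|g x| + M * `|f x| * (e1 * `|y - x|)
   + M * ((`|L| + 1) * `|y - x|) * e1 = (e1 * (c - 1)) * `|y - x|.
  by rewrite /c; ring.
rewrite ler_wpM2r//; nra.
Qed.
End product.

Lemma Cn_add n Y Om (f g : X -> Y) : open Om ->
  Cn n Om f -> Cn n Om g -> Cn n Om (fun x => f x + g x).
Proof.
move=> oO; elim: n Y f g => [|n IH] Y f g.
  move=> /(Cn0P _ oO) fc /(Cn0P _ oO) gc; apply/(Cn0P _ oO) => x Ox e e0.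
  have e20 : 0 < e / 2 by rewrite divr_gt0.
  have [d d0 dP] := fc x Ox _ e20; have [c c0 cP] := gc x Ox _ e20.
  exists (Num.min d c); first by rewrite lt_min d0.
  move=> y; rewrite lt_min => /andP[/dP yd /cP yc].
  rewrite opprD addrACA (le_lt_trans (ler_normD _ _))// [ltRHS](splitr e) ltrD//.
move=> [D [dD CD]] [E [dE CE]]; exists (fun x => D x + E x); split; last exact: IH.
by move=> x Ox; apply: is_diff_add; [exact: dD|exact: dE].
Qed.

(** By the product rule the derivative is a sum of two terms of the same shape, with the
    operator-valued bilinear maps [bo_bil]; the induction therefore ranges over all spaces and all
    [B]. *)
Lemma Cn_bilin n Y1 Y2 Z (B : Y1 -> Y2 -> Z) M Om f g : bilin B M -> open Om ->
  Cn n Om f -> Cn n Om g -> Cn n Om (fun x => B (f x) (g x)).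
Proof.
move=> hB oO; elim: n Y1 Y2 Z B M hB f g => [|n IH] Y1 Y2 Z B M hB f g.
  move=> /(Cn0P _ oO) fc /(Cn0P _ oO) gc; apply/(Cn0P _ oO) => x Ox e e0.
  have M0 := bilin_ge0 hB.
  pose c := M * (`|f x| + `|g x| + 1) + 1.
  have c0 : 0 < c by rewrite /c ltr_wpDl// mulr_ge0// !addr_ge0.
  pose e1 := Num.min 1 (e / c).
  have e10 : 0 < e1 by rewrite lt_min ltr01 divr_gt0// mulr_gt0.
  have e1c : e1 * c <= e by rewrite -ler_pdivlMr// ge_min lexx orbT.
  have e11 : e1 <= 1 by rewrite ge_min lexx.
  have [d d0 dP] := fc x Ox _ e10; have [a a0 aP] := gc x Ox _ e10.
  exists (Num.min d a); first by rewrite lt_min d0.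
  move=> y; rewrite lt_min => /andP[/dP yd /aP ya].
  have -> : B (f y) (g y) - B (f x) (g x) = B (f y - f x) (g x) + B (f x) (g y - g x)
     + B (f y - f x) (g y - g x).
    by rewrite !(bilinBl _ _ _ hB) !(bilinBr _ _ _ hB); lmod R.
  apply: (@le_lt_trans _ _ (M * e1 * `|g x| + M * `|f x| * e1 + M * e1 * e1)).
    rewrite (le_trans (ler_normD _ _))// lerD//.
      rewrite (le_trans (ler_normD _ _))// lerD//.
        by rewrite (le_trans (bilin_ub hB _ _))// ler_wpM2r// ler_wpM2l// ltW.
      by rewrite (le_trans (bilin_ub hB _ _))// ler_wpM2l ?mulr_ge0// ltW.
    rewrite (le_trans (bilin_ub hB _ _))// ler_pM ?mulr_ge0//.
      by rewrite ler_wpM2l// ltW.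
    exact: ltW.
  have : M * e1 * e1 <= M * e1 by rewrite ler_piMr// mulr_ge0// ltW.
  have -> : M * e1 * `|g x| + M * `|f x| * e1 = e1 * (c - 1) - M * e1 by rewrite /c; ring.
  nra.
move=> Cf Cg; have [D [dD CD]] := Cf; have [E [dE CE]] := Cg.
exists (fun x => bo_bil hB (D x) (g x) + bo_bil (bilinC hB) (E x) (f x)); split.
  by move=> x Ox; apply: bilin_diff; [exact: dD|exact: dE].
apply: Cn_add => //.
- by apply: (IH _ _ _ _ _ (bilin_bo_bil hB)) => //; exact: Cn_pred.
- by apply: (IH _ _ _ _ _ (bilin_bo_bil (bilinC hB))) => //; exact: Cn_pred.
Qed.

Lemma bilin_scale Y : bilin (fun (a : R) (y : Y) => a *: y) 1.
Proof.
split=> //.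
- by move=> z a u v /=; rewrite scalerDl scalerA.
- by move=> y a u v /=; rewrite scalerDr !scalerA mulrC.
- by move=> y z; rewrite normrZ mul1r.
Qed.

Lemma Cn_scale n Y Om (f : X -> R) (g : X -> Y) : open Om ->
  Cn n Om f -> Cn n Om g -> Cn n Om (fun x => f x *: g x).
Proof. by move=> oO; apply: Cn_bilin => //; exact: bilin_scale. Qed.

Lemma Cn_mul n Om (f g : X -> R) : open Om ->
  Cn n Om f -> Cn n Om g -> Cn n Om (fun x => f x * g x).
Proof. by move=> oO; exact: Cn_scale. Qed.

Lemma Cn_opp n Y Om (f : X -> Y) : open Om ->
  Cn n Om f -> Cn n Om (fun x => - f x).
Proof.
move=> oO Cf; apply: (Cn_eq (g := fun x => (-1) *: f x)) => //.
  by move=> x _; rewrite scaleN1r.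
by apply: Cn_scale => //; exact: Cn_cst.
Qed.

Lemma Cn_sum n Y Om (I : Type) (s : seq I) (f : I -> X -> Y) : open Om ->
  (forall i, Cn n Om (f i)) -> Cn n Om (fun x => \sum_(i <- s) f i x).
Proof.
move=> oO Cf; elim: s => [|i s IH].
  by apply: (Cn_eq (g := fun=> 0)) => //; [move=> x _; rewrite big_nil|exact: Cn_cst].
apply: (Cn_eq (g := fun x => f i x + \sum_(j <- s) f j x)) => //.
  by move=> x _; rewrite big_cons.
exact: Cn_add.
Qed.

Lemma Cn_prod n Om (I : Type) (s : seq I) (f : I -> X -> R) : open Om ->
  (forall i, Cn n Om (f i)) -> Cn n Om (fun x => \prod_(i <- s) f i x).
Proof.
move=> oO Cf; elim: s => [|i s IH].
  by apply: (Cn_eq (Y := R) (g := fun=> 1)) => //; [move=> x _; rewrite big_nil|exact: Cn_cst].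
apply: (Cn_eq (Y := R) (g := fun x => f i x * \prod_(j <- s) f j x)) => //.
  by move=> x _; rewrite big_cons.
exact: Cn_mul.
Qed.

End Cn_bilinear.

(** * Composition with affine maps and with scalar functions *)

Section Cn_compose.
Context {R : realType} {X : normedModType R}.
Implicit Types (Y Z : normedModType R) (Om : set X).

Lemma Cn_affine n Y Om Om' (g : X -> Y) (a : R) (s : X) : open Om -> open Om' ->
  (forall x, Om' x -> Om (a *: (x - s))) ->
  Cn n Om g -> Cn n Om' (fun x => g (a *: (x - s))).
Proof.
move=> oO oO' OO; have a10 : 0 < `|a| + 1 by rewrite ltr_wpDl.
have aP (d : R) x y : 0 < d -> `|y - x| < d / (`|a| + 1) ->
    `|a *: (y - s) - a *: (x - s)| < d.
  move=> d0; rewrite ltr_pdivlMr// => yx.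
  have -> : a *: (y - s) - a *: (x - s) = a *: (y - x) by lmod R.
  by rewrite normrZ (le_lt_trans _ yx)// mulrC ler_wpM2l// lerDl.
elim: n Y g => [|n IH] Y g.
  move=> /(Cn0P _ oO) gc; apply/(Cn0P _ oO') => x /OO Ox e e0.
  have [d d0 dP] := gc _ Ox e e0; exists (d / (`|a| + 1)); first by rewrite divr_gt0.
  by move=> y yx; apply: dP; exact: aP.
move=> [D [gD CD]]; exists (fun x => a *: D (a *: (x - s))); split; last first.
  by apply: Cn_scale => //; [exact: Cn_cst|exact: IH].
move=> x /OO /gD /is_diffP gDx; apply/is_diffP => e e0.
have [d d0 dP] := gDx (e / (`|a| + 1)) (divr_gt0 e0 a10).
exists (d / (`|a| + 1)); first by rewrite divr_gt0.
move=> y yx; rewrite boZE -linearZ/=.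
have axy : a *: (y - s) - a *: (x - s) = a *: (y - x) by lmod R.
have := dP (a *: (y - s)) (aP _ _ _ d0 yx); rewrite axy => /le_trans; apply.
rewrite normrZ mulrA ler_wpM2r// mulrAC ler_pdivrMr// ler_wpM2l ?(ltW e0)//.
by rewrite lerDl.
Qed.

Definition deriv_at (f : R -> R) (t df : R) := forall e : R, 0 < e ->
  exists2 d : R, 0 < d & forall s,
    `|s - t| < d -> `|f s - f t - df * (s - t)| <= e * `|s - t|.

Lemma is_diff_comp_real (h : R -> R) (dh : R) (w : X -> R) x (L : 'L(X; R)) :
  deriv_at h (w x) dh -> is_diff x w L -> is_diff x (fun y => h (w y)) (dh *: L).
Proof.
move=> hd wL; have /is_diffP dw := wL; apply/is_diffP => e e0.
pose c := `|L| + 1; have c0 : 0 < c by rewrite ltr_wpDl.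
pose b := `|dh| + 1; have b0 : 0 < b by rewrite ltr_wpDl.
have e1 : 0 < e / 2 / c by rewrite !divr_gt0.
have e2 : 0 < Num.min 1 (e / 2 / b) by rewrite lt_min ltr01 !divr_gt0.
have [d d0 dP] := hd _ e1.
have [r r0 rP] := is_diff_cont wL d0.
have [q q0 qP] := dw _ e2.
exists (Num.min r q); first by rewrite lt_min r0.
move=> y; rewrite lt_min => /andP[/rP/dP yr /qP yq].
rewrite boZE.
have -> : h (w y) - h (w x) - dh *: L (y - x) =
  (h (w y) - h (w x) - dh * (w y - w x)) + dh * (w y - w x - L (y - x)).
  by rewrite /GRing.scale/=; ring.
rewrite (le_trans (ler_normD _ _))// [in leRHS](splitr e) mulrDl lerD//.
  have wyx : `|w y - w x| <= c * `|y - x|.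
    rewrite -[w y - w x](subrK (L (y - x))) (le_trans (ler_normD _ _))//.
    rewrite addrC /c mulrDl lerD ?opnorm_ub// (le_trans yq)// ler_wpM2r//.
    by rewrite ge_min lexx.
  rewrite (le_trans yr)// -[leLHS]mulrA ler_wpM2l// ?divr_ge0 ?(ltW e0)//.
  by rewrite mulrC ler_pdivrMr// mulrC.
rewrite normrM (le_trans (ler_wpM2l _ yq))// mulrA ler_wpM2r//.
apply: (@le_trans _ _ (b * (e / 2 / b))).
  apply: ler_pM => //; first by rewrite ltW.
    by rewrite lerDl.
  by rewrite ge_min lexx orbT.
by rewrite mulrC divfK// gt_eqF.
Qed.

(** The scalar function is a member of a family closed under differentiation, [next] giving the
    index of the derivative. This replaces iterated derivatives: each step of the induction only
    moves the index. *)
Lemma Cn_comp_real n (J : Type) (F : J -> R -> R) (next : J -> J) (I : set R)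
    Om (w : X -> R) j : open Om -> (forall x, Om x -> I (w x)) ->
  (forall j t, I t -> deriv_at (F j) t (F (next j) t)) ->
  Cn n Om w -> Cn n Om (fun x => F j (w x)).
Proof.
move=> oO OI dF; elim: n j => [|n IH] j.
  move=> /(Cn0P _ oO) wc; apply/(Cn0P _ oO) => x Ox e e0.
  have [d d0 dP] := dF j _ (OI _ Ox) 1 ltr01.
  pose c := `|F (next j) (w x)| + 1; have c0 : 0 < c by rewrite ltr_wpDl.
  have [|r r0 rP] := wc x Ox (Num.min d (e / c)).
    by rewrite lt_min d0 divr_gt0.
  exists r => // y /rP; rewrite lt_min ltr_pdivlMr// => /andP[/dP Fyx].
  apply: le_lt_trans.
  rewrite -[F j _ - F j _](subrK (F (next j) (w x) * (w y - w x))).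
  rewrite (le_trans (ler_normD _ _))// (le_trans (lerD Fyx (lexx _)))//.
  by rewrite normrM /c mulrDr mul1r mulr1 addrC lerD// mulrC.
move=> Cw; have [D [wD CD]] := Cw.
exists (fun x => F (next j) (w x) *: D x); split; last first.
  by apply: Cn_scale => //; apply: IH; exact: Cn_pred.
by move=> x Ox; apply: is_diff_comp_real; [exact/dF/OI|exact: wD].
Qed.

End Cn_compose.

Section Ck_calculus.
Context {R : realType} {X : normedModType R}.
Implicit Types (Y Z : normedModType R) (Om : set X) (k : option nat).

(** One quantified order covers both forms of [k], so facts about [Cn] transfer to finite and
    infinite order at once. *)
Lemma CkP k Y Om (f : X -> Y) :
  Ck k Om f <-> forall n, (if k is Some m then n = m else True) -> Cn n Om f.
Proof.
case: k => [m|] /=; split => [H|H]; [by move=> _ ->|exact: H|by move=> n _|].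
by move=> n; exact: H.
Qed.

Lemma CkW k Y Om Om' (f : X -> Y) : Om' `<=` Om -> Ck k Om f -> Ck k Om' f.
Proof. by move=> OO /CkP Cf; apply/CkP => n /Cf; exact: CnW. Qed.

Lemma Ck_local k Y Om (f : X -> Y) : open Om ->
  (forall x, Om x -> exists r : R, exists g : X -> Y,
    [/\ 0 < r, Ck k [set y | `|y - x| < r] g &
        forall y, `|y - x| < r -> f y = g y]) ->
  Ck k Om f.
Proof.
move=> oO H; apply/CkP => n kn; apply: Cn_local => // x /H [r [g [r0 /CkP Cg fg]]].
by exists r, g; split => //; exact: Cg.
Qed.

Lemma Ck_eq k Y Om (f g : X -> Y) : open Om ->
  (forall x, Om x -> f x = g x) -> Ck k Om g -> Ck k Om f.
Proof. by move=> oO fg /CkP Cg; apply/CkP => n /Cg; exact: Cn_eq. Qed.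

Lemma Ck_cst k Y Om (c : Y) : open Om -> Ck k Om (fun=> c).
Proof. by move=> oO; apply/CkP => n _; exact: Cn_cst. Qed.

Lemma Ck_lin k Y Om (T : 'L(X; Y)) : open Om -> Ck k Om T.
Proof. by move=> oO; apply/CkP => n _; exact: Cn_lin. Qed.

Lemma Ck_add k Y Om (f g : X -> Y) : open Om ->
  Ck k Om f -> Ck k Om g -> Ck k Om (fun x => f x + g x).
Proof.
by move=> oO /CkP Cf /CkP Cg; apply/CkP => n kn; apply: Cn_add; auto.
Qed.

Lemma Ck_opp k Y Om (f : X -> Y) : open Om ->
  Ck k Om f -> Ck k Om (fun x => - f x).
Proof. by move=> oO /CkP Cf; apply/CkP => n /Cf; exact: Cn_opp. Qed.

Lemma Ck_scale k Y Om (f : X -> R) (g : X -> Y) : open Om ->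
  Ck k Om f -> Ck k Om g -> Ck k Om (fun x => f x *: g x).
Proof.
by move=> oO /CkP Cf /CkP Cg; apply/CkP => n kn; apply: Cn_scale; auto.
Qed.

Lemma Ck_bo k Y Z Om (f : X -> Y) (T : 'L(Y; Z)) : open Om ->
  Ck k Om f -> Ck k Om (fun x => T (f x)).
Proof.
move=> oO /CkP Cf; apply/CkP => n kn.
(* Composition with [T] is treated as a product with the constant scalar function 1. *)
have hB : bilin (fun (c : R) (y : Y) => c *: T y) `|T|.
  split=> //.
  - by move=> z a u v /=; rewrite scalerDl scalerA.
  - by move=> y a u v /=; rewrite linearP scalerDr !scalerA mulrC.
  - by move=> y z; rewrite normrZ mulrC [leRHS]mulrAC ler_wpM2r// opnorm_ub.
apply: (Cn_eq (g := fun x => 1 *: T (f x))) => //.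
  by move=> x _; rewrite scale1r.
by apply: (Cn_bilin hB) => //; [exact: Cn_cst|exact: Cf].
Qed.

Lemma Ck_sum k Y Om (I : Type) (s : seq I) (f : I -> X -> Y) : open Om ->
  (forall i, Ck k Om (f i)) -> Ck k Om (fun x => \sum_(i <- s) f i x).
Proof.
move=> oO Cf; apply/CkP => n kn; apply: Cn_sum => // i.
by have /CkP := Cf i; exact.
Qed.

Lemma Ck_prod k Om (I : Type) (s : seq I) (f : I -> X -> R) : open Om ->
  (forall i, Ck k Om (f i)) -> Ck k Om (fun x => \prod_(i <- s) f i x).
Proof.
move=> oO Cf; apply/CkP => n kn; apply: Cn_prod => // i.
by have /CkP := Cf i; exact.
Qed.

Lemma Ck_affine k Y Om Om' (g : X -> Y) (a : R) (s : X) : open Om -> open Om' ->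
  (forall x, Om' x -> Om (a *: (x - s))) ->
  Ck k Om g -> Ck k Om' (fun x => g (a *: (x - s))).
Proof. by move=> oO oO' OO /CkP Cg; apply/CkP => n /Cg; exact: Cn_affine. Qed.

Lemma Ck_comp_real k (J : Type) (F : J -> R -> R) (next : J -> J) (I : set R)
    Om (w : X -> R) j : open Om -> (forall x, Om x -> I (w x)) ->
  (forall j t, I t -> deriv_at (F j) t (F (next j) t)) ->
  Ck k Om w -> Ck k Om (fun x => F j (w x)).
Proof.
by move=> oO OI dF /CkP Cw; apply/CkP => n /Cw; exact: Cn_comp_real OI dF.
Qed.

Lemma Ck1 k Y Om (f : X -> Y) : open Om -> k <> Some 0%N ->
  Ck k Om f -> Cn 1 Om f.
Proof.
move=> oO; case: k => [[//|m] _ |_]; last exact.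
by rewrite /Ck; elim: m => // m IH /(Cn_pred oO).
Qed.

End Ck_calculus.

(** * A smooth step function *)

Section smooth_step.
Context {R : realType}.

Lemma deriv_at_is_derive (f : R -> R) (t df : R) :
  is_derive t 1 f df -> deriv_at f t df.
Proof.
move=> [fd fdf] e e0; rewrite -fdf /derive.
have /cvgrPdist_le/(_ e e0) := fd.
rewrite near_withinE => /nbhsNP[d d0 dP]; exists d => // s st.
have [->|st0] := eqVneq s t; first by rewrite !subrr mulr0 subr0 normr0 mulr0.
have := dP (s - t); rewrite subr0 => /(_ st); rewrite subr_eq0 => /(_ st0).
set l := lim _; rewrite /= [_ *: 1]mulr1 subrK => H.
have s0 : s - t != 0 by rewrite subr_eq0.
have -> : f s - f t - l * (s - t) = - ((l - (s - t)^-1 * (f s - f t)) * (s - t)).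
  by field.
by rewrite normrN normrM ler_wpM2r.
Qed.

Lemma deriv_at_near (f g : R -> R) (t df r : R) : 0 < r ->
  (forall s, `|s - t| < r -> f s = g s) -> deriv_at f t df -> deriv_at g t df.
Proof.
move=> r0 fg fd e e0; have [d d0 dP] := fd e e0.
exists (Num.min d r); first by rewrite lt_min d0.
by move=> s; rewrite lt_min => /andP[/dP sd sr]; rewrite -!fg ?subrr ?normr0.
Qed.

(* The functions p(1/t) exp(-1/t), extended by 0 to t <= 0, are closed under
   differentiation. *)
Definition flat (p : {poly R}) (t : R) : R :=
  if 0 < t then p.[t^-1] * expR (- t^-1) else 0.

Lemma is_derive_horner (p : {poly R}) (t : R) :
  is_derive t 1 (fun s => p.[s]) p^`().[t].
Proof.
elim/poly_ind: p => [|p c IH].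
  rewrite deriv0 horner0.
  have -> : (fun s : R => (0 : {poly R}).[s]) = cst 0.
    by apply/funext => s; rewrite horner0.
  exact: is_derive_cst.
have -> : (fun s => (p * 'X + c%:P).[s]) = (fun s => p.[s] * s + c).
  by apply/funext => s; rewrite !hornerE.
apply: is_derive_eq; rewrite derivD derivC addr0 derivM derivX mulr1 !hornerE.
by rewrite /GRing.scale /= mulr1 addrC mulrC.
Qed.

Lemma exprn_expRN_le (i : nat) (y : R) : 0 <= y -> y ^+ i * expR (- y) <= i`!%:R.
Proof.
move=> y0; rewrite expRN ler_pdivrMr ?expR_gt0//; case: i => [|i].
  by rewrite expr0 fact0 mul1r (le_trans _ (expR_ge1Dx y))// lerDl.
rewrite mulrC -ler_pdivrMr ?ltr0n ?fact_gt0//.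
by rewrite (le_trans _ (expR_ge1Dxn i y0))// lerDr.
Qed.

Lemma horner_expRN_bound (p : {poly R}) :
  exists2 K : R, 0 < K & forall y, 0 <= y -> `|p.[y]| * expR (- y) <= K.
Proof.
exists (1 + \sum_(i < size p) `|p`_i| * i`!%:R).
  by rewrite ltr_pwDl// sumr_ge0// => i _; rewrite mulr_ge0.
move=> y y0; rewrite horner_coef.
rewrite (@le_trans _ _ ((\sum_(i < size p) `|p`_i| * y ^+ i) * expR (- y)))//.
  rewrite ler_wpM2r ?expR_ge0// (le_trans (ler_norm_sum _ _ _))// ler_sum// => i _.
  by rewrite normrM [`|y ^+ i|]ger0_norm// exprn_ge0.
rewrite mulr_suml ler_wpDl// ler_sum// => i _.
by rewrite -mulrA ler_wpM2l// exprn_expRN_le.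
Qed.

(** With y = 1/t one has dy/dt = -y^2, whence the polynomial X^2 (p - p'). Only t = 0 needs an
    argument of its own. *)
Lemma flat_deriv p t : deriv_at (flat p) t (flat ('X^2 * (p - p^`())) t).
Proof.
have [t0|t0|->] := ltgtP t 0.
- rewrite /flat (lt_gtF t0).
  apply: (@deriv_at_near (cst 0) _ t 0 (- t)); first by rewrite oppr_gt0.
    move=> s; rewrite ltr_norml => /andP[_ st]; rewrite ifF//.
    by apply/negbTE; rewrite -leNgt; lra.
  move=> e e0; exists 1 => // s _.
  by rewrite /= subrr mul0r subr0 normr0 mulr_ge0 ?(ltW e0).
- apply: (@deriv_at_near (fun s => p.[s^-1] * expR (- s^-1)) _ t _ t t0).
    move=> s; rewrite ltr_norml => /andP[st _]; rewrite /flat ifT//.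
    by lra.
  rewrite /flat t0; apply: deriv_at_is_derive.
  have tn : t != 0 by rewrite gt_eqF.
  have dV : is_derive t 1 (fun s : R => s^-1) (- t ^- 2).
    have := @is_deriveV R id t 1 1 tn (is_derive_id _ _).
    by rewrite /GRing.scale/= mulr1.
  have dp : is_derive t 1 (fun s : R => p.[s^-1]) (p^`().[t^-1] * - t ^- 2).
    exact: (@is_derive1_comp R (fun s => p.[s]) (fun s : R => s^-1) _ _ _
      (is_derive_horner p t^-1) dV).
  have dN : is_derive t 1 (fun s : R => - s^-1) (t ^- 2).
    by apply: is_derive_eq; rewrite opprK.
  have de : is_derive t 1 (fun s : R => expR (- s^-1)) (expR (- t^-1) * t ^- 2).
    exact: (@is_derive1_comp R expR (fun s : R => - s^-1)).
  apply: is_derive_eq; rewrite !hornerE /GRing.scale/= exprVn; ring.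
move=> e e0; rewrite /flat /= ltxx.
(* A bound for X^2 p instead of p gives [|flat p s| <= K s^2], hence derivative 0 at 0. *)
have [K K0 KP] := horner_expRN_bound ('X^2 * p).
exists (e / K); first by rewrite divr_gt0.
move=> s; rewrite subr0 => sK; rewrite mul0r !subr0.
case: ifP => s0; last by rewrite normr0 mulr_ge0 ?(ltW e0).
have := KP s^-1; rewrite invr_ge0 => /(_ (ltW s0)).
rewrite hornerM hornerXn normrM normrX (gtr0_norm (x := s^-1)) ?invr_gt0// => H.
rewrite normrM [`|expR _|]ger0_norm ?expR_ge0//.
move: sK; rewrite (gtr0_norm s0)// => sK.
have s1 : s != 0 by rewrite gt_eqF.
have -> : `|p.[s^-1]| * expR (- s^-1) =
  s ^+ 2 * (s^-1 ^+ 2 * `|p.[s^-1]| * expR (- s^-1)) by field.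
apply: (@le_trans _ _ (s ^+ 2 * K)); first by rewrite ler_wpM2l// exprn_ge0// ltW.
rewrite expr2 -mulrA [leRHS]mulrC ler_wpM2l ?(ltW s0)//.
by rewrite -ler_pdivlMr// ltW.
Qed.

Lemma inv_deriv (J := (R * nat)%type) (j : J) (t : R) : 0 < t ->
  deriv_at (fun s => j.1 * s ^- j.2.+1) t ((- j.1 * j.2.+1%:R) * t ^- j.2.+2).
Proof.
move=> t0; apply: deriv_at_is_derive; case: j => c m /=.
have tn : t != 0 by rewrite gt_eqF.
have dX : is_derive t 1 (fun s : R => s ^+ m.+1) (m.+1%:R * t ^+ m).
  have := is_derive_horner ('X^(m.+1)) t.
  rewrite derivXn hornerMn hornerXn -mulr_natl; congr (is_derive _ _ _ _).
  by apply/funext => s; rewrite hornerXn.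
have dV := @is_deriveV R (fun s : R => s ^+ m.+1) t _ 1 (expf_neq0 m.+1 tn) dX.
apply: is_derive_eq; rewrite /GRing.scale/= !exprS; field.
by rewrite tn expf_neq0.
Qed.

End smooth_step.

(** * Paths and the mean value inequality *)

Section real_induction.
Context {R : realType}.

(** Applied at the supremum T of the good points, the step hypothesis with [b = t] carries [Q] up to
    T, and with [a = t] it carries [Q] beyond T unless T = 1. *)
Lemma real_induction (Q : R -> Prop) : Q 0 ->
  (forall t, 0 <= t <= 1 -> exists2 d : R, 0 < d & forall a b,
     0 <= a -> a < b -> b <= 1 -> a = t \/ b = t -> b - a < d -> Q a -> Q b) ->
  Q 1.
Proof.
move=> Q0 Qstep.
pose S := [set t : R | 0 <= t <= 1 /\ Q t].
have S0 : S 0 by split=> //; rewrite lexx ler01.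
have hS : has_sup S by split; [exists 0|exists 1 => t [/andP[]]].
pose T := sup S.
have T0 : 0 <= T by apply: (ub_le_sup (proj2 hS)).
have T1 : T <= 1 by apply: ge_sup; [exists 0|move=> t [/andP[]]].
have T01 : 0 <= T <= 1 by rewrite T0 T1.
have [d d0 dP] := Qstep T T01.
have QT : Q T.
  have [t [/andP[t0 t1] Qt] tT] := sup_adherent d0 hS.
  have tleT : t <= T by apply: (ub_le_sup (proj2 hS)); split=> //; rewrite t0 t1.
  move: tleT; rewrite le_eqVlt => /predU1P[<- //|tltT].
  by apply: (dP t) => //; [right|rewrite ltrBlDr -ltrBlDl].
move: T1; rewrite le_eqVlt => /predU1P[<- //|Tlt1].
pose b := Num.min 1 (T + d / 2).
have Tb : T < b by rewrite lt_min Tlt1 ltrDl divr_gt0.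
have b1 : b <= 1 by rewrite ge_min lexx.
have Qb : Q b.
  apply: (dP T) => //; first by left.
  rewrite ltrBlDl (@le_lt_trans _ _ (T + d / 2))//; first by rewrite ge_min lexx orbT.
  by rewrite ltrD2l ltr_pdivrMr// mulr_natr mulr2n ltrDl.
have : b <= T.
  by apply: (ub_le_sup (proj2 hS)); split => //; rewrite b1 (le_trans T0)// ltW.
by rewrite leNgt Tb.
Qed.

End real_induction.

Section paths.
Context {R : realType}.
Implicit Types X Y : normedModType R.

Lemma polygon_length_rcons X (a b c : R) (g : R -> X) s : last a s = b ->
  polygon_length a c g (rcons s c) = polygon_length a b g s + `|g c - g b|.
Proof.
move=> sb; rewrite /polygon_length size_rcons big_nat_recr//=; congr (_ + _).
  rewrite !big_nat; apply: eq_bigr => i /andP[_ si].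
  rewrite -rcons_cons !nth_rcons /= ltnS (ltnW si) si.
  by congr (`| g _ - g _ |); apply: set_nth_default => //=; rewrite ltnS ltnW.
rewrite -rcons_cons !nth_rcons /= ltnSn ltnn eqxx.
by rewrite -sb (last_nth c).
Qed.

(** Real induction builds the partition edge by edge; on each edge the local estimate is available
    at one of the two endpoints. No regularity of [g] is required, and the polygon is later compared
    with the length of the curve. *)
Lemma path_lip X Y (u : R -> Y) (g : R -> X) (e : R) :
  (forall t, 0 <= t <= 1 -> exists2 d : R, 0 < d & forall s,
     0 <= s <= 1 -> `|s - t| < d -> `|u s - u t| <= e * `|g s - g t|) ->
  exists2 s, itv_partition 0 1 s & `|u 1 - u 0| <= e * polygon_length 0 1 g s.
Proof.
move=> ug; pose Q (t : R) := exists2 s,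
  itv_partition 0 t s & `|u t - u 0| <= e * polygon_length 0 t g s.
apply: (real_induction (Q := Q)).
  exists [::]; first by split => /=.
  by rewrite subrr normr0 /polygon_length big_geq// mulr0.
move=> t /[dup] /andP[t0 t1] /ug [d d0 dP]; exists d => // a b a0 ab b1 abt bad.
move=> [s [pas /eqP las] us]; exists (rcons s b).
  by split; rewrite ?last_rcons// rcons_path pas las.
rewrite (polygon_length_rcons _ _ las) mulrDr.
have -> : u b - u 0 = (u a - u 0) + (u b - u a) by lmod R.
rewrite (le_trans (ler_normD _ _))// lerD//.
have [at_|bt] := abt.
  rewrite at_; apply: dP; first by rewrite b1 (le_trans a0)// ltW.
  by rewrite -at_ ger0_norm// subr_ge0 ltW.
rewrite bt distrC [in leRHS]distrC; apply: dP.
  by rewrite a0 (le_trans _ b1)// ltW.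
by rewrite -bt distrC ger0_norm// subr_ge0 ltW.
Qed.

Lemma segment_lip X Y (h : X -> Y) (x y : X) (e : R) :
  (forall t, 0 <= t <= 1 -> exists2 d : R, 0 < d & forall w,
     `|w - (x + t *: (y - x))| < d ->
     `|h w - h (x + t *: (y - x))| <= e * `|w - (x + t *: (y - x))|) ->
  `|h y - h x| <= e * `|y - x|.
Proof.
move=> hl; pose g t := x + t *: (y - x).
have gE s t : g s - g t = (s - t) *: (y - x) by rewrite /g; lmod R.
have c0 : 0 < `|y - x| + 1 by rewrite ltr_wpDl.
suff : `|h (g 1) - h (g 0)| <= e * (1 * `|y - x|).
  have -> : g 1 = y by rewrite /g; lmod R.
  have -> : g 0 = x by rewrite /g; lmod R.
  by rewrite mul1r.
apply: (real_induction (Q := fun t => `|h (g t) - h (g 0)| <= e * (t * `|y - x|))).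
  by rewrite subrr normr0 mul0r mulr0.
move=> t /hl [d d0 dP]; exists (d / (`|y - x| + 1)); first by rewrite divr_gt0.
move=> a b a0 ab b1 abt; rewrite ltr_pdivlMr// => bad H.
have ba : `|b - a| = b - a by rewrite ger0_norm// subr_ge0 ltW.
have gba : `|g b - g a| < d.
  rewrite gE normrZ ba (le_lt_trans _ bad)// ler_wpM2l ?lerDl// subr_ge0 ltW//.
have -> : h (g b) - h (g 0) = (h (g b) - h (g a)) + (h (g a) - h (g 0)) by lmod R.
have -> : e * (b * `|y - x|) = e * ((b - a) * `|y - x|) + e * (a * `|y - x|) by ring.
rewrite (le_trans (ler_normD _ _))// lerD// -ba -normrZ -gE.
case: abt => [at_|bt]; first by subst a; exact: dP.
by subst b; rewrite distrC [in leRHS]distrC; apply: dP; rewrite distrC.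
Qed.

End paths.

(** * The step function and its Lipschitz bound, by the mean value inequality *)

Section step.
Context {R : realType}.

Lemma flat1E (t : R) : flat 1 t = if 0 < t then expR (- t^-1) else 0.
Proof. by rewrite /flat; case: ifP => // _; rewrite hornerE mul1r. Qed.

Lemma flat1_ge0 (t : R) : 0 <= flat 1 t.
Proof. by rewrite flat1E; case: ifP => // _; rewrite expR_ge0. Qed.

Lemma flat1_le0 (t : R) : t <= 0 -> flat 1 t = 0.
Proof. by rewrite flat1E leNgt => /negbTE ->. Qed.

Lemma flat1_gt0 (t : R) : 0 < t -> 0 < flat 1 t.
Proof. by rewrite flat1E => ->; rewrite expR_gt0. Qed.

Lemma flat1_mono (s t : R) : 0 < s -> s <= t -> flat 1 s <= flat 1 t.
Proof.
move=> s0 st; rewrite !flat1E s0 (lt_le_trans s0 st) ler_expR lerN2.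
by rewrite lef_pV2// posrE (lt_le_trans s0).
Qed.

Lemma flat1_lip (s t : R) : `|flat 1 s - flat 1 t| <= 3 * `|s - t|.
Proof.
have d2 (a : R) : `|flat ('X^2 * (1 - 1^`())) a| <= 2.
  rewrite derivC subr0 mulr1 /flat; case: ifP => a0; last by rewrite normr0.
  rewrite hornerXn ger0_norm ?mulr_ge0 ?expR_ge0 ?exprn_ge0 ?invr_ge0 ?(ltW a0)//.
  by apply: exprn_expRN_le; rewrite invr_ge0 ltW.
apply: (@segment_lip R R R (flat 1)) => a _; set z := _ + _.
have [d d0 dP] := flat_deriv (1 : {poly R}) z ltr01.
exists d => // w /dP; set b := flat _ z => H.
rewrite -[flat 1 w - _](subrK (flat ('X^2 * (1 - 1^`())) z * (w - z))).
rewrite (le_trans (ler_normD _ _))// -[3]/(1 + 2) mulrDl lerD//.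
by rewrite normrM ler_wpM2r.
Qed.

(** The margins 1/4 at both ends absorb the approximation error 1/8 in [bump]. *)
Definition step (t : R) : R :=
  flat 1 (t - 4^-1) / (flat 1 (t - 4^-1) + flat 1 (3 / 4 - t)).

(** On either side of 1/2 one of the two arguments is at least 1/4. *)
Lemma step_den (t : R) : flat 1 4^-1 <= flat 1 (t - 4^-1) + flat 1 (3 / 4 - t).
Proof.
have [t1|t1] := leP (2^-1) t.
  rewrite (@le_trans _ _ (flat 1 (t - 4^-1)))//; last by rewrite lerDl flat1_ge0.
  by apply: flat1_mono => //; lra.
rewrite (@le_trans _ _ (flat 1 (3 / 4 - t)))//; last by rewrite lerDr flat1_ge0.
by apply: flat1_mono => //; lra.
Qed.

Lemma flat1_quarter : 0 < flat 1 (4^-1 : R).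
Proof. by rewrite flat1_gt0. Qed.

Lemma step_den_gt0 (t : R) : 0 < flat 1 (t - 4^-1) + flat 1 (3 / 4 - t).
Proof. exact: lt_le_trans flat1_quarter (step_den t). Qed.

Lemma step_ge0 t : 0 <= step t.
Proof. by rewrite divr_ge0 ?flat1_ge0// ltW// step_den_gt0. Qed.

Lemma step_le1 t : step t <= 1.
Proof. by rewrite ler_pdivrMr ?step_den_gt0// mul1r lerDl flat1_ge0. Qed.

Lemma step_eq0 t : t <= 4^-1 -> step t = 0.
Proof. by move=> t1; rewrite /step flat1_le0 ?mul0r// subr_le0. Qed.

Lemma step_eq1 t : 3 / 4 <= t -> step t = 1.
Proof.
move=> t1; have := step_den_gt0 t; rewrite /step (@flat1_le0 (3 / 4 - t)) ?subr_le0//.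
by rewrite addr0 => t0; rewrite divff// gt_eqF.
Qed.

Lemma step_lip : exists2 K : R, 0 < K & forall s t, `|step s - step t| <= K * `|s - t|.
Proof.
exists (3 / flat 1 4^-1); first by rewrite divr_gt0// flat1_quarter.
move=> s t; rewrite /step.
set a := flat 1 (s - _); set b := flat 1 (_ - s).
set a' := flat 1 (t - _); set b' := flat 1 (_ - t).
have ab : 0 < a + b by exact: step_den_gt0.
have ab' : 0 < a' + b' by exact: step_den_gt0.
have -> : a / (a + b) - a' / (a' + b') =
  ((a - a') * b' + a' * (b' - b)) / ((a + b) * (a' + b')).
  by field; rewrite !gt_eqF.
rewrite normrM normfV [`|_ * (a' + b')|]gtr0_norm ?mulr_gt0//.
have aP : `|a - a'| <= 3 * `|s - t|.
  by rewrite (le_trans (flat1_lip _ _))// ler_wpM2l// le_eqVlt; apply/orP; left;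
    apply/eqP; congr `|_|; ring.
have bP : `|b' - b| <= 3 * `|s - t|.
  by rewrite (le_trans (flat1_lip _ _))// ler_wpM2l// le_eqVlt; apply/orP; left;
    apply/eqP; congr `|_|; ring.
have a0 : 0 <= a' by exact: flat1_ge0.
have b0 : 0 <= b' by exact: flat1_ge0.
have n0 : 0 <= `|s - t| by [].
apply: (@le_trans _ _ (3 * `|s - t| * (a' + b') / ((a + b) * (a' + b')))).
  rewrite ler_wpM2r ?invr_ge0 ?mulr_ge0 ?(ltW ab) ?(ltW ab')//.
  rewrite (le_trans (ler_normD _ _))// !normrM (ger0_norm a0) (ger0_norm b0).
  by rewrite mulrDr addrC lerD// ?[a' * _]mulrC ler_wpM2r.
have -> : 3 * `|s - t| * (a' + b') / ((a + b) * (a' + b')) = 3 * `|s - t| / (a + b).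
  by field; rewrite !gt_eqF.
rewrite mulrAC ler_wpM2r// ler_wpM2l// lef_pV2 ?posrE ?flat1_quarter//.
exact: step_den.
Qed.

Lemma Ck_step (X : normedModType R) k (Om : set X) (w : X -> R) : open Om ->
  Ck k Om w -> Ck k Om (fun x => step (w x)).
Proof.
move=> oO Cw.
have C1 : Ck k Om (fun x => flat 1 (w x - 4^-1)).
  apply: (Ck_comp_real (F := @flat R) (I := setT) 1 oO) => //.
    by move=> j t _; exact: flat_deriv.
  by apply: Ck_add => //; exact: Ck_cst.
have C2 : Ck k Om (fun x => flat 1 (3 / 4 - w x)).
  apply: (Ck_comp_real (F := @flat R) (I := setT) 1 oO) => //.
    by move=> j t _; exact: flat_deriv.
  by apply: Ck_add => //; [exact: Ck_cst|exact: Ck_opp].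
apply: (Ck_scale (Y := R)) => //.
apply: (Ck_eq (g := fun x => 1 * (flat 1 (w x - 4^-1) + flat 1 (3 / 4 - w x)) ^- 1)) => //.
  by move=> x _; rewrite mul1r expr1.
(* The reciprocal belongs to the family c t^-(m+1), indexed by (c, m) and closed under
   differentiation; it is the member (1, 0). *)
apply: (Ck_comp_real (F := fun j s => j.1 * s ^- j.2.+1)
  (next := fun j => (- j.1 * j.2.+1%:R, j.2.+1)) (I := [set t | 0 < t]) (1, 0%N) oO) => //.
- by move=> x _; exact: step_den_gt0.
- by move=> j t t0; exact: inv_deriv.
- exact: Ck_add.
Qed.

End step.

(** * A separating functional *)

Section functional.
Context {R : realType} {Y : normedModType R}.

Record sublinear (q : Y -> R) : Prop := Sublinear {
  subl_add : forall x y, q (x + y) <= q x + q y;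
  subl_scale : forall a x, 0 <= a -> q (a *: x) <= a * q x }.

Lemma sublN q x : sublinear q -> - q (- x) <= q x.
Proof.
move=> hq; have q0 : 0 <= q 0.
  by have := subl_add hq 0 0; rewrite addr0; lra.
by have := subl_add hq x (- x); rewrite subrr; lra.
Qed.

(* The largest sublinear minorant of [q] that is at most [- q z] at [- z]. A
   minimal sublinear functional coincides with all its shifts, which makes it
   additive: this replaces the usual extension of partial functionals. *)
Definition subl_shift (q : Y -> R) (z y : Y) : R :=
  inf [set q (y + t *: z) - t * q z | t in [set t | 0 <= t]].

Section shift.
Variables (q : Y -> R) (hq : sublinear q) (z : Y).

Lemma subl_shift_lb y : lbound
  [set q (y + t *: z) - t * q z | t in [set t | 0 <= t]] (- q (- y)).
Proof.
move=> _ [t /= t0 <-]; have := subl_add hq (y + t *: z) (- y).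
rewrite addrAC subrr add0r => h1.
have := subl_scale hq z t0; have := sublN (t *: z) hq => h2 h3.
have : t * q z <= q (t *: z).
  have [->|tn] := eqVneq t 0; first by rewrite mul0r scale0r;
    have := subl_add hq 0 0; rewrite addr0; lra.
  have tp : 0 < t by rewrite lt_def tn.
  have := subl_scale hq (t *: z) (a := t^-1); rewrite invr_ge0 => /(_ t0).
  by rewrite scalerA mulVf// scale1r ler_pdivlMl.
lra.
Qed.

Lemma subl_shift_le y t : 0 <= t -> subl_shift q z y <= q (y + t *: z) - t * q z.
Proof.
move=> t0; apply: ge_inf; last by exists t.
by exists (- q (- y)); exact: subl_shift_lb.
Qed.

Lemma subl_shift_le0 y : subl_shift q z y <= q y.
Proof.
by have := subl_shift_le y (lexx 0); rewrite scale0r addr0 mul0r subr0.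
Qed.

Lemma subl_shift_ge y c : (forall t, 0 <= t -> c <= q (y + t *: z) - t * q z) ->
  c <= subl_shift q z y.
Proof.
move=> H; apply: lb_le_inf; first by exists (q (y + 0 *: z) - 0 * q z), 0 => //=.
by move=> _ [t /= t0 <-]; exact: H.
Qed.

Lemma subl_shift_sublinear : sublinear (subl_shift q z).
Proof.
split=> [x y|a x].
  rewrite -lerBlDr; apply: subl_shift_ge => t t0.
  rewrite lerBlDr [leRHS]addrC -lerBlDr; apply: subl_shift_ge => s s0.
  rewrite lerBlDr (le_trans (subl_shift_le _ (addr_ge0 t0 s0)))//.
  have := subl_add hq (x + t *: z) (y + s *: z).
  have -> : x + y + (t + s) *: z = x + t *: z + (y + s *: z) by lmod R.
  lra.
rewrite le_eqVlt => /predU1P[<-|a0].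
  rewrite scale0r mul0r (le_trans (subl_shift_le0 _))//.
  by have := subl_scale hq 0 (lexx 0); rewrite scale0r mul0r.
rewrite -ler_pdivrMl//; apply: subl_shift_ge => t t0.
rewrite ler_pdivrMl// (le_trans (subl_shift_le _ (mulr_ge0 (ltW a0) t0)))//.
have -> : a *: x + (a * t) *: z = a *: (x + t *: z) by lmod R.
by have := subl_scale hq (x + t *: z) (ltW a0); lra.
Qed.
End shift.

Lemma sublinear_norm : sublinear (fun y : Y => `|y|).
Proof.
by split=> [x y|a x a0]; [exact: ler_normD|rewrite normrZ ger0_norm].
Qed.

Lemma exists_functional (y0 : Y) : y0 != 0 -> exists phi : 'L(Y; R), phi y0 = 1.
Proof.
(* Taking t = 1 in the shift of the norm gives [p (- y0) <= - |y0|]. Every linear minorant of [p] is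
   then positive at [y0]. *)
move=> y00; pose p := subl_shift (fun y : Y => `|y|) y0.
have hp : sublinear p := subl_shift_sublinear sublinear_norm y0.
have pn y : p y <= `|y| by exact: subl_shift_le0 sublinear_norm _ _.
pose T := {q : Y -> R | sublinear q /\ forall y, q y <= p y}.
(* The order is reversed, so that the maximal element given by [Zorn] is a minimal sublinear
   functional. *)
pose rel (s t : T) : bool := `[< forall y, sval t y <= sval s y >].
have lb (t : T) y : - `|y| <= sval t y.
  case: t => q [hq qp] /=; have := sublN y hq.
  by have := le_trans (qp (- y)) (pn (- y)); rewrite normrN; lra.
have [] := @Zorn T rel.
- by move=> t; apply/asboolP.
- move=> r s t /asboolP rs /asboolP st; apply/asboolP => y.
  exact: le_trans (st y) (rs y).
- move=> [s hs] [t ht] /asboolP/= st /asboolP/= ts.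
  apply: eq_exist; apply/funext => y; apply/eqP.
  by rewrite eq_le st ts.
- move=> A Atot; have [[t0 At0]|A0] := pselect (exists t, A t); last first.
    by exists (exist _ p (conj hp (fun y => lexx _))) => s As; exfalso; apply: A0; exists s.
  pose B y := [set sval t y | t in A].
  have Blb y : has_lbound (B y).
    by exists (- `|y|) => _ [t _ <-]; exact: lb.
  have Bne y : B y !=set0 by exists (sval t0 y), t0.
  pose q y := inf (B y).
  have qle t y : A t -> q y <= sval t y by move=> At; apply: ge_inf => //; exists t.
  have hq : sublinear q.
    split=> [x y|a x a0].
      rewrite -lerBlDr; apply: lb_le_inf => // _ [t1 At1 <-].
      rewrite lerBlDr [leRHS]addrC -lerBlDr; apply: lb_le_inf => // _ [t2 At2 <-].
      rewrite lerBlDr.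
      (* Subadditivity of the infimum: of two members of the chain the pointwise smaller one serves
         for both arguments. *)
      have [/asboolP t12|/asboolP t21] := Atot _ _ At1 At2.
        rewrite (le_trans (qle _ _ At2))// (le_trans (subl_add (proj1 (svalP t2)) _ _))//.
        by rewrite addrC lerD2l t12.
      rewrite (le_trans (qle _ _ At1))// (le_trans (subl_add (proj1 (svalP t1)) _ _))//.
      by rewrite [leLHS]addrC lerD2r t21.
    move: a0; rewrite le_eqVlt => /predU1P[<-|a0].
      rewrite scale0r mul0r (le_trans (qle _ _ At0))//.
      by have := subl_scale (proj1 (svalP t0)) 0 (lexx 0); rewrite scale0r mul0r.
    rewrite -ler_pdivrMl//; apply: lb_le_inf => // _ [t At <-].
    rewrite ler_pdivrMl// (le_trans (qle _ _ At))//.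
    by have [hs _] := svalP t; exact: (subl_scale hs x (ltW a0)).
  have qp y : q y <= p y by rewrite (le_trans (qle _ _ At0))//; case: (svalP t0).
  exists (exist _ q (conj hq qp)) => s As; apply/asboolP => y; exact: qle.
move=> [q [hq qp]] qmin.
have qD x y : q (x + y) = q x + q y.
  apply/eqP; rewrite eq_le subl_add//=.
  have hs := subl_shift_sublinear hq y.
  have sp z : subl_shift q y z <= p z by rewrite (le_trans (subl_shift_le0 _ _ _)).
  have := qmin (exist _ _ (conj hs sp)).
  have -> : rel (exist _ q (conj hq qp)) (exist _ _ (conj hs sp)).
    by apply/asboolP => z /=; exact: subl_shift_le0.
  (* By minimality [q] equals its shift by [y]; the term t = 1 of the shift yields
     [q x <= q (x + y) - q y]. *)
  move=> /(_ isT)/(congr1 sval)/= /funeqP/(_ x) E.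
  have := subl_shift_le hq y x ler01; rewrite E scale1r mul1r; lra.
have q0 : q 0 = 0 by have := qD 0 0; rewrite addr0; lra.
have qN x : q (- x) = - q x by have := qD x (- x); rewrite subrr q0; lra.
have qZ a x : 0 <= a -> q (a *: x) = a * q x.
  move=> a0; apply/eqP; rewrite eq_le subl_scale//=.
  by have := subl_scale hq (- x) a0; rewrite scalerN !qN; lra.
have ql : linear (q : Y -> R).
  move=> a x y; rewrite qD; congr (_ + _); rewrite -[RHS]/(a * q x).
  have [a0|a0] := leP 0 a; first exact: qZ.
  have -> : a *: x = - ((- a) *: x) by rewrite scaleNr opprK.
  by rewrite qN qZ ?mulNr ?opprK// oppr_ge0 ltW.
have qb y : `|q y| <= 1 * `|y|.
  rewrite mul1r ler_norml (le_trans (qp y) (pn y)) andbT.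
  by have := le_trans (qp (- y)) (pn (- y)); rewrite normrN qN; lra.
have qy0 : 0 < q y0.
  have := qp (- y0); have := subl_shift_le sublinear_norm y0 (- y0) ler01.
  rewrite scale1r addNr normr0 mul1r sub0r -/p qN.
  have : 0 < `|y0| by rewrite normr_gt0.
  by move=> /=; rewrite -/(p (- y0)); lra.
exists ((q y0)^-1 *: bo_of ql qb).
by rewrite boZE /= /GRing.scale/= mulVf// gt_eqF.
Qed.

End functional.

(** * Real-valued approximation from vector-valued approximation *)

Section scalar_LA.
Context {R : realType}.

(** The function [u] is smoothed as the map [u x *: y0] into [Y] and read back by a functional equal
    to 1 at [y0]. *)
Lemma LA_scalar (k : option nat) (X Y : normedModType R) (y0 : Y) :
  y0 != 0 -> LA k X Y -> LA k X R.
Proof.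
move=> y00 [C C0 H]; have [phi phi1] := exists_functional y00.
exists (`|phi| * (C * `|y0|)); first by rewrite !mulr_ge0.
move=> L u L0 uL e e0.
have phi0 : 0 < `|phi| + 1 by rewrite ltr_wpDl.
have [|||g [gL gk ge]] := H (L * `|y0|) (fun x => u x *: y0) _ _ (e / (`|phi| + 1)).
- by rewrite mulr_ge0.
- move=> [x y] xy /=; rewrite -scalerBl normrZ mulrAC ler_wpM2r//.
  exact: uL (x, y) xy.
- by rewrite divr_gt0.
exists (fun x => phi (g x)); split.
- move=> [x y] xy /=; rewrite -linearB/= (le_trans (opnorm_ub _ _))//.
  have := gL (x, y) xy => /= /(ler_wpM2l (normr_ge0 phi)) /le_trans; apply.
  by rewrite le_eqVlt; apply/orP; left; apply/eqP; ring.
- by apply: Ck_bo => //; exact: ball_open.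
apply: ge_ereal_sup => _ [x xU <-]; rewrite lee_fin.
have -> : u x - phi (g x) = phi (u x *: y0 - g x).
  by rewrite linearB linearZ/= phi1 /GRing.scale/= mulr1.
have : `|u x *: y0 - g x| <= e / (`|phi| + 1).
  by rewrite -lee_fin (le_trans _ ge)//; apply: ereal_sup_ubound; exists x.
move=> ux; rewrite (le_trans (opnorm_ub _ _))// (le_trans (ler_wpM2l _ ux))//.
  exact: opnorm_ge0.
by rewrite mulrA ler_pdivrMr// [leLHS]mulrC ler_wpM2l ?(ltW e0)// lerDl.
Qed.

End scalar_LA.

(** * Bump functions *)

Section LA_ball.
Context {R : realType}.

Lemma open_ball_norm (X : normedModType R) (x : X) :
  @open_unit_ball R X x = (`|x| < 1) :> Prop.
Proof.
rewrite /open_unit_ball -ball_normE /=.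
by rewrite sub0r normrN.
Qed.

(** Rescaling to the unit ball multiplies the Lipschitz constant by [r] and scaling back divides it
    by [r], so [C] serves for balls of every size. *)
Lemma LA_ball k (X Y : normedModType R) : LA k X Y ->
  exists2 C : R, 0 <= C & forall (s : X) (r L eta : R) (q : X -> Y),
    0 < r -> 0 <= L -> 0 < eta ->
    (forall x y, `|x - s| < r -> `|y - s| < r -> `|q x - q y| <= L * `|x - y|) ->
    exists w : X -> Y, [/\ Ck k [set x | `|x - s| < r] w,
      (forall x y, `|x - s| < r -> `|y - s| < r -> `|w x - w y| <= C * L * `|x - y|) &
      (forall x, `|x - s| < r -> `|q x - w x| <= eta)].
Proof.
move=> [C C0 H]; exists C => // s r L eta q r0 L0 eta0 qL.
have rn : r != 0 by rewrite gt_eqF.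
have B1 x : @open_unit_ball R X x -> `|s + r *: x - s| < r.
  rewrite open_ball_norm => x1; have -> : s + r *: x - s = r *: x by lmod R.
  by rewrite normrZ gtr0_norm// -[ltRHS]mulr1 ltr_pM2l.
have B2 x : `|x - s| < r -> @open_unit_ball R X (r^-1 *: (x - s)).
  by rewrite open_ball_norm normrZ gtr0_norm ?invr_gt0// ltr_pdivrMl// mulr1.
have sK x : s + r *: (r^-1 *: (x - s)) = x by rewrite scalerA divff// scale1r addrC subrK.
have [||//|g [gL gk ge]] := H (L * r) (fun x => q (s + r *: x)) _ _ eta.
- by rewrite mulr_ge0// ltW.
- move=> [x y] [/= /B1 x1 /B1 y1]; rewrite (le_trans (qL _ _ x1 y1))//.
  have -> : s + r *: x - (s + r *: y) = r *: (x - y) by lmod R.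
  by rewrite normrZ gtr0_norm// mulrA.
exists (fun x => g (r^-1 *: (x - s))); split.
- by apply: (Ck_affine (Om := @open_unit_ball R X)) => //; [exact: ball_open|exact: open_bN].
- move=> x y /B2 x1 /B2 y1; have := gL (_, _) (conj x1 y1) => /= /le_trans; apply.
  have -> : r^-1 *: (x - s) - r^-1 *: (y - s) = r^-1 *: (x - y) by lmod R.
  rewrite normrZ gtr0_norm ?invr_gt0// le_eqVlt; apply/orP; left; apply/eqP.
  by field.
- move=> x /B2 x1; rewrite -lee_fin -[X in q X]sK (le_trans _ ge)//.
  by apply: ereal_sup_ubound; exists (r^-1 *: (x - s)).
Qed.
End LA_ball.

Section distance.
Context {R : realType} {X : normedModType R}.
Implicit Types (A : set X) (x y : X).

Definition dist A x : R := inf [set `|x - a| | a in A].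

Lemma dist_ge0 A x : 0 <= dist A x.
Proof.
have [->|A0] := eqVneq A set0; first by rewrite /dist image_set0 inf0.
apply: lb_le_inf; first by move/set0P: A0 => [a Aa]; exists `|x - a|, a.
by move=> _ [a _ <-].
Qed.

Lemma dist_le A x a : A a -> dist A x <= `|x - a|.
Proof. by move=> Aa; apply: ge_inf; [exists 0 => _ [b _ <-]|exists a]. Qed.

Lemma dist_lt A x t : A !=set0 -> dist A x < t -> exists2 a, A a & `|x - a| < t.
Proof.
move=> [a0 Aa0]; rewrite -subr_gt0 => e0.
have [|_ [a Aa <-]] := @inf_adherent R [set `|x - a| | a in A] _ e0.
  by split; [exists `|x - a0|, a0|exists 0 => _ [b _ <-]].
by rewrite -/(dist A x) [ltRHS]addrC subrK => xa; exists a.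
Qed.

Lemma dist_lip A x y : A !=set0 -> `|dist A x - dist A y| <= `|x - y|.
Proof.
move=> A0; have H u v : dist A u - dist A v <= `|u - v|.
  rewrite lerBlDr -lerBlDl; have [a0 Aa0] := A0; apply: lb_le_inf.
    by exists `|v - a0|, a0.
  move=> _ [a Aa <-]; rewrite lerBlDl (le_trans (dist_le u Aa))//.
  by rewrite -[u - a](subrKA v) ler_normD.
by rewrite ler_norml H andbT lerNl opprB distrC H.
Qed.

Lemma dist_gt0 A x : closed A -> A !=set0 -> ~ A x -> 0 < dist A x.
Proof.
move=> cA A0 nAx; rewrite lt_neqAle dist_ge0 andbT; apply/eqP => d0.
apply: nAx; rewrite closure_id in cA; rewrite cA => B /nbhsNP [e e0 eB].
have [|a Aa xa] := @dist_lt A x e A0; first by rewrite -d0.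
by exists a; split=> //; apply: eB; rewrite distrC.
Qed.

Lemma pow2_small (e : R) : 0 < e -> exists n : nat, 2 ^- n < e.
Proof.
move=> e0; exists (Num.Def.archi_bound e^-1).
rewrite invf_plt ?posrE ?exprn_gt0//.
by apply: upper_nthrootP.
Qed.
End distance.

Section bump.
Context {R : realType} {X : normedModType R} (k : option nat).
Hypothesis hLA : LA k X R.

(** [v] is [step] applied to a smooth approximation of the tent of height 1 and slope [4 / a] over
    [T]. The hypothesis places [T] so deep inside the ball of radius [r], where (LA_k) is used, that
    the bump can be continued by 0. The constant depends neither on the set nor on the ball. *)
Lemma bump : exists2 K : R, 0 <= K & forall (T : set X) (s : X) (r a : R),
  0 < a -> (forall t, T t -> `|t - s| + a <= r / 4) ->
  exists v : X -> R, [/\ Ck k setT v, (forall x, 0 <= v x <= 1),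
    (forall x, v x != 0 -> exists2 t, T t & `|x - t| < a / 4),
    (forall t x, T t -> `|x - t| < a / 32 -> v x = 1) &
    (forall x y, `|v x - v y| <= K / a * `|x - y|)].
Proof.
have [C C0 HC] := LA_ball hLA; have [K K0 stepK] := @step_lip R.
(* [K * (C * 4)] belongs to pairs inside the ball; the 1 is for a point of the support and a point
   outside the ball, which are at least [a] apart. *)
exists (K * (C * 4) + 1); first by rewrite addr_ge0// !mulr_ge0// ltW.
move=> T s r a a0 Ta; have [T0|/set0P T0] := eqVneq T set0.
  exists (fun=> 0); split => //.
  - exact/Ck_cst/openT.
  - by move=> _; rewrite lexx ler01.
  - by move=> x; rewrite eqxx.
  - by move=> t x; rewrite T0.
  - by move=> x y; rewrite subrr normr0 !mulr_ge0 ?invr_ge0 ?addr_ge0// ?mulr_ge0// ltW.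
have r0 : 0 < r.
  by have [t /Ta] := T0; have := normr_ge0 (t - s); lra.
have ra : 4 * a <= r.
  by have [t /Ta] := T0; have := normr_ge0 (t - s); lra.
pose u x := Num.max 0 (1 - 4 / a * dist T x).
have a4 : 0 < 4 / a by rewrite divr_gt0.
have uL x y : `|u x - u y| <= 4 / a * `|x - y|.
  rewrite (@le_trans _ _ `|(1 - 4 / a * dist T x) - (1 - 4 / a * dist T y)|)//.
    rewrite /u; set p := 1 - _; set q := 1 - _.
    by rewrite !maxEle; case: ifP; case: ifP; move=> h1 h2;
      rewrite ler_norml; apply/andP; split; case: (ger0P (p - q)); lra.
  have -> : 1 - 4 / a * dist T x - (1 - 4 / a * dist T y) =
     4 / a * (dist T y - dist T x) by ring.
  by rewrite normrM (gtr0_norm a4) ler_wpM2l ?(ltW a4)// distrC dist_lip.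
(* With error 1/8, [w > 1/4] forces [u > 0], and [u >= 7/8] forces [w >= 3/4]: these are the
   thresholds of [step]. *)
have [||||w [wk wL wu]] := HC s r (4 / a) 8^-1 u => //.
  exact: ltW.
have st x : u x > 0 -> exists2 t, T t & `|x - t| < a / 4.
  rewrite /u lt_max ltxx /= subr_gt0 => h; apply: dist_lt => //.
  by move: h; rewrite mulrAC ltr_pdivrMr// mul1r mulrC -ltr_pdivlMr.
pose v x := if `|x - s| < r then step (w x) else 0.
have v0 x : v x != 0 -> exists2 t, T t & `|x - t| < a / 4.
  rewrite /v; case: ifP => [xs|_]; last by rewrite eqxx.
  move=> sw; apply: st; have : 4^-1 < w x.
    by rewrite ltNge; apply: contraNN sw => /step_eq0 ->.
  by have := wu x xs; rewrite ler_norml => /andP[]; lra.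
have vs x : v x != 0 -> `|x - s| < r / 4.
  move=> /v0 [t Tt xt]; have := Ta t Tt; have := ler_normD (x - t) (t - s).
  by rewrite subrKA; lra.
have v01 x : 0 <= v x <= 1.
  by rewrite /v; case: ifP; rewrite ?step_ge0 ?step_le1// lexx ler01.
exists v; split => //.
- apply: Ck_local; first exact: openT.
  move=> x _; have [xs|xs] := ltP `|x - s| r.
    have [d d0 dP] := open_ballN (open_bN s r) xs.
    exists d, (fun x => step (w x)); split => //.
      apply: Ck_step; first exact: open_bN.
      by apply: CkW wk => y /dP.
    by move=> y /dP /= ys; rewrite /v ys.
  exists (r / 2), (fun=> 0); split.
  - by rewrite divr_gt0.
  - exact/Ck_cst/open_bN.
  - move=> y yx; apply/eqP; apply: contraTT isT => /vs ys.
    by have := ler_normD (x - y) (y - s); rewrite subrKA (distrC x y); lra.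
- move=> t x Tt xt; have xs : `|x - s| < r.
    by have := Ta t Tt; have := ler_normD (x - t) (t - s); rewrite subrKA; lra.
  rewrite /v xs step_eq1//; have := wu x xs; rewrite ler_norml => /andP[_].
  have : 7 / 8 <= u x; last by lra.
  rewrite /u le_max; apply/orP; right.
  have := ler_wpM2l (ltW a4) (le_trans (dist_le x Tt) (ltW xt)).
  have -> : 4 / a * (a / 32) = 8^-1 by field; rewrite gt_eqF.
  lra.
have KC : K * (C * (4 / a)) <= (K * (C * 4) + 1) / a.
  have -> : (K * (C * 4) + 1) / a = K * (C * (4 / a)) + a^-1 by ring.
  by rewrite lerDl invr_ge0 ltW.
have KC0 : 0 <= K * (C * 4) by rewrite !mulr_ge0// ltW.
have K1 : 0 <= (K * (C * 4) + 1) / a by rewrite divr_ge0 ?addr_ge0 ?(ltW a0).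
have out x y : `|x - s| < r -> r <= `|y - s| ->
    `|v x - v y| <= (K * (C * 4) + 1) / a * `|x - y|.
  move=> xs ys; have vy : v y = 0 by rewrite /v ltNge ys.
  rewrite vy subr0; have [->|/vs xs'] := eqVneq (v x) 0.
    by rewrite normr0 mulr_ge0.
  have axy : a <= `|x - y|.
    by have := ler_normD (y - x) (x - s); rewrite subrKA (distrC y x); lra.
  have /andP[vx0 vx1] := v01 x; rewrite ger0_norm// (le_trans vx1)//.
  by rewrite mulrAC ler_pdivlMr// mul1r (le_trans axy)// ler_peMl// lerDr.
move=> x y; have [xs|xs] := ltP `|x - s| r; have [ys|ys] := ltP `|y - s| r.
- rewrite /v xs ys (le_trans (stepK _ _))// (le_trans (ler_wpM2l (ltW K0) (wL _ _ xs ys)))//.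
  by rewrite !mulrA ler_wpM2r// -!mulrA.
- exact: out.
- by rewrite distrC [in leRHS]distrC; exact: out.
- by rewrite /v !ltNge xs ys/= subrr normr0 mulr_ge0.
Qed.
End bump.

(** * Partitions of unity and smoothing *)

Section partition.
Context {R : realType} {X : normedModType R} (k : option nat).

(* [v n] is the sum of a uniformly discrete family of bumps, and [c n x] is the
   centre of the bump of this family that is active at [x] (junk if there is none). *)
Record bump_system (Om : set X) (r : X -> R) (v : nat -> X -> R)
    (c : nat -> X -> X) (L : nat -> R) : Prop := BumpSystem {
  bs_Ck : forall n, Ck k setT (v n);
  bs_01 : forall n x, 0 <= v n x <= 1;
  bs_center : forall n x, v n x != 0 -> Om (c n x) /\ `|x - c n x| < r (c n x) / 4;
  bs_discrete : forall n x y, v n x != 0 -> v n y != 0 ->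
    `|x - y| < 2 ^- n / 2 -> c n x = c n y;
  bs_ge0 : forall n, 0 <= L n;
  bs_lip : forall n x y, `|v n x - v n y| <= L n * `|x - y|;
  bs_cover : forall x, Om x -> exists N, exists2 d : R, 0 < d &
    forall y, `|y - x| < d -> v N y = 1 }.

Hypothesis hLA : LA k X R.

Lemma wo_least (T : eqType) : exists lt : T -> T -> Prop,
  (forall s t, s <> t -> lt s t \/ lt t s) /\
  (forall P : set T, P !=set0 -> exists2 s, P s & forall t, P t -> ~ lt t s).
Proof.
have [W hW] := well_ordering_principle T.
have minW (P : set T) : P !=set0 -> exists2 s, P s & forall t, P t -> W s t.
  move=> [x Px]; have [|s [[sP smin] _]] := hW [pred y | `[< P y >]].
    by exists x; apply/asboolP.
  exists s; first by move/asboolP: sP.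
  by move=> t Pt; apply: smin; apply/asboolP.
have uniq s t : W s t -> W t s -> s = t.
  move=> st ts; have [|m [_ mU]] := hW [pred y | (y == s) || (y == t)].
    by exists s; rewrite inE eqxx.
  have Wss u : W u u.
    by have [|u' -> ] := minW [set u]; [exists u|exact].
  rewrite -(mU s); first apply: mU.
    split; first by rewrite !inE eqxx orbT.
    by move=> u; rewrite !inE => /orP[]/eqP ->.
  split; first by rewrite !inE eqxx.
  by move=> u; rewrite !inE => /orP[]/eqP ->.
exists (fun s t => W s t /\ s <> t); split.
  move=> s t st; have [|u [->|->] H] := minW [set u | u = s \/ u = t].
  - by exists s; left.
  - by left; split => //; apply: H; right.
  - by right; split; [apply: H; left|exact/nesym].
move=> P /minW[s Ps H]; exists s => // t Pt [ts tns].
by apply: tns; apply: uniq => //; exact: H.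
Qed.

Lemma exists_bump_system (Om : set X) (r : X -> R) : (forall s, Om s -> 0 < r s) ->
  exists v c L, bump_system Om r v c L.
Proof.
move=> r0; have [K K0 HK] := bump hLA.
have [lt [lt_total lt_least]] := wo_least X.
pose a n : R := 2 ^- n.
have a0 n : 0 < a n by rewrite invr_gt0 exprn_gt0.
(* Stone's construction: for fixed n the sets T n s are 2^-n-separated. *)
pose T n s := [set x | [/\ Om s, `|x - s| + a n <= r s / 4 &
  forall t, Om t -> lt t s -> r t / 4 <= `|x - t|]].
have Tsep n s t x y : T n s x -> T n t y -> s <> t -> a n <= `|x - y|.
  move=> [Os xs sP] [Ot yt tP] /lt_total[st|ts].
    have := tP _ Os st; have := ler_normD (y - x) (x - s).
    by rewrite subrKA (distrC y x); lra.
  by have := sP _ Ot ts; have := ler_normD (x - y) (y - t); rewrite subrKA; lra.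
have /choice[w wP] : forall p : nat * X, exists v : X -> R,
    [/\ Ck k setT v, (forall x, 0 <= v x <= 1),
    (forall x, v x != 0 -> exists2 t, T p.1 p.2 t & `|x - t| < a p.1 / 4),
    (forall t x, T p.1 p.2 t -> `|x - t| < a p.1 / 32 -> v x = 1) &
    (forall x y, `|v x - v y| <= K / a p.1 * `|x - y|)].
  by move=> [n s]; apply: (HK _ s (r s)) => // t [].
(* Separation makes the active index unique. If there is none, the default is [x] itself, and
   [v n x] is 0 all the same. *)
pose c n x := xget x [set s | w (n, s) x != 0].
pose v n x := w (n, c n x) x.
have wT n s x : w (n, s) x != 0 -> exists2 t, T n s t & `|x - t| < a n / 4.
  by have [_ _ H _ _] := wP (n, s); exact: H.
have wsep n s t x y : w (n, s) x != 0 -> w (n, t) y != 0 -> `|x - y| < a n / 2 -> s = t.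
  move=> /wT [p Tp xp] /wT [q Tq yq] xy; apply: contrapT => st.
  have := Tsep _ _ _ _ _ Tp Tq st; have := ler_normD (p - x) (x - q).
  have := ler_normD (x - y) (y - q); rewrite !subrKA (distrC p x); lra.
have cE n s x : w (n, s) x != 0 -> c n x = s.
  move=> ws; rewrite /c; case: xgetP => [t _ /= wt|/(_ s)//].
  by apply: (wsep n _ _ x x) => //; rewrite subrr normr0 divr_gt0.
have vw n s x : v n x = 0 -> w (n, s) x = 0.
  move=> v0; apply/eqP; apply: contraT => ws.
  by move: v0; rewrite /v (cE _ _ _ ws) => w0; rewrite w0 eqxx in ws.
have v01 n x : 0 <= v n x <= 1 by have [_ + _ _ _] := wP (n, c n x); exact.
have csep n x y : v n x != 0 -> v n y != 0 -> `|x - y| < a n / 2 -> c n x = c n y.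
  exact: wsep.
have lipw n s x y : `|w (n, s) x - w (n, s) y| <= K / a n * `|x - y|.
  by have [_ _ _ _] := wP (n, s); exact.
(* Either a single bump accounts for both values, or two different ones are active and the points
   are at least [a n / 2] apart; the second case costs the summand [2 / a n]. *)
have lip1 n x y : v n x != 0 -> `|v n x - v n y| <= (K / a n + 2 / a n) * `|x - y|.
  move=> vx; rewrite mulrDl.
  have [cxy|cxy] := pselect (v n y = w (n, c n x) y).
    by rewrite cxy (le_trans (lipw _ _ _ _))// lerDl mulr_ge0// divr_ge0 ?(ltW (a0 n)).
  have vy : v n y != 0.
    by apply/eqP => vy; apply: cxy; rewrite vy (vw _ _ _ vy).
  have axy : a n / 2 <= `|x - y|.
    rewrite leNgt; apply/negP => axy; apply: cxy.
    by rewrite /v (csep _ _ _ vx vy axy).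
  apply: (@le_trans _ _ 1).
    by have := v01 n x; have := v01 n y => /andP[? ?] /andP[? ?]; rewrite ler_norml; lra.
  have h1 : 1 <= 2 / a n * `|x - y|.
    by rewrite mulrAC ler_pdivlMr// mul1r mulrC -ler_pdivrMr.
  by rewrite (le_trans h1)// lerDr mulr_ge0// divr_ge0// ltW.
exists v, c, (fun n => K / a n + 2 / a n); split => //.
- move=> n; apply: Ck_local; first exact: openT.
  move=> x _; have a4 : 0 < a n / 4 by rewrite divr_gt0.
  have [[y yx vy]|nv] := pselect (exists2 y, `|y - x| < a n / 4 & v n y != 0).
    exists (a n / 4), (w (n, c n y)); split => //.
      by have [wk _ _ _ _] := wP (n, c n y); apply: CkW wk.
    move=> z zx; have [vz|vz] := eqVneq (v n z) 0; first by rewrite vz vw.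
    rewrite /v (csep _ _ _ vz vy)//.
    by have := ler_normD (z - x) (x - y); rewrite subrKA (distrC x y); lra.
  exists (a n / 4), (fun=> 0); split => //; first exact/Ck_cst/open_bN.
  move=> y yx; apply/eqP; apply: contraT => vy.
  by exfalso; apply: nv; exists y.
- move=> n x /wT [t [Ot tc _] xt]; split => //.
  by have := ler_normD (x - t) (t - c n x); rewrite subrKA; have := a0 n; lra.
- by move=> n; rewrite addr_ge0// divr_ge0// ltW.
- move=> n x y; have [vx|vx] := eqVneq (v n x) 0; last exact: lip1.
  have [vy|vy] := eqVneq (v n y) 0.
    by rewrite vx vy subrr normr0 mulr_ge0// addr_ge0// divr_ge0// ltW.
  by rewrite distrC [in leRHS]distrC; exact: lip1.
- move=> x Ox.
  (* No ball of smaller index contains [x] in its quarter, so [x] lies in [T n s] as soon as 2^-n is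
     below the margin [r s / 4 - |x - s|]. *)
  have [|s [Os xs] smin] := lt_least [set t | Om t /\ `|x - t| < r t / 4].
    by exists x; split => //; rewrite subrr normr0 divr_gt0// r0.
  have [n nP] := pow2_small (ltac:(rewrite subr_gt0; exact: xs) : 0 < r s / 4 - `|x - s|).
  have Tx : T n s x.
    split => //; first by rewrite /a; lra.
    move=> t Ot ts; rewrite leNgt; apply/negP => xt.
    exact: smin ts.
  exists n, (a n / 32); first by rewrite divr_gt0.
  move=> y yx; have [_ _ _ /(_ x y Tx yx) wy _] := wP (n, s).
  by rewrite /v (cE n s) wy// oner_neq0.
Qed.

End partition.

Section sums.
Context {R : realType}.

Lemma sum_pow2 (N : nat) : \sum_(0 <= n < N) 2 ^- n = 2 - 2 * 2 ^- N :> R.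
Proof.
elim: N => [|N IH]; first by rewrite big_geq// expr0 invr1 mulr1 subrr.
rewrite big_nat_recr//= IH exprS; field.
by rewrite expf_neq0.
Qed.

Lemma sum_pow2_le (N : nat) : \sum_(0 <= n < N) 2 ^- n <= 2 :> R.
Proof.
by rewrite sum_pow2 lerBlDr lerDl mulr_ge0// invr_ge0 exprn_ge0.
Qed.

Lemma mul_unit_lip (a b a' b' : R) : 0 <= a' <= 1 -> 0 <= b <= 1 ->
  `|a * b - a' * b'| <= `|a - a'| + `|b - b'|.
Proof.
move=> /andP[a0 a1] /andP[b0 b1].
have -> : a * b - a' * b' = (a - a') * b + a' * (b - b') by ring.
rewrite (le_trans (ler_normD _ _))// !normrM (ger0_norm a0) (ger0_norm b0).
by rewrite lerD// ?ler_piMr// ler_piMl.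
Qed.
End sums.

(** * Weights of a bump system and gluing of local maps *)

Section gluing.
Context {R : realType} {X : normedModType R} (k : option nat).

Section weights.
Variables (Om : set X) (r : X -> R) (v : nat -> X -> R) (c : nat -> X -> X).
Variables (L : nat -> R) (hb : bump_system k Om r v c L).

(** What is left of 1 after the first [n] weights. It vanishes past any index with [v N x = 1], so
    the weights sum to 1 without a division. *)
Definition remainder n x : R := \prod_(0 <= j < n) (1 - v j x).
Definition weight n x : R := remainder n x * v n x.

Lemma remainderS n x : remainder n.+1 x = remainder n x * (1 - v n x).
Proof. by rewrite /remainder big_nat_recr. Qed.

Lemma remainder_01 n x : 0 <= remainder n x <= 1.
Proof.
elim: n => [|n /andP[p0 p1]]; first by rewrite /remainder big_geq// ler01 lexx.
have /andP[v0 v1] := bs_01 hb n x.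
by rewrite remainderS mulr_ge0 ?subr_ge0//= mulr_ile1 ?subr_ge0// gerBl.
Qed.

Lemma weight_01 n x : 0 <= weight n x <= 1.
Proof.
have /andP[p0 p1] := remainder_01 n x; have /andP[v0 v1] := bs_01 hb n x.
by rewrite mulr_ge0//= mulr_ile1.
Qed.

Lemma weight_neq0 n x : weight n x != 0 -> v n x != 0.
Proof. by apply: contraNN => /eqP; rewrite /weight => ->; rewrite mulr0. Qed.

Lemma sum_weight N x : \sum_(0 <= n < N) weight n x = 1 - remainder N x.
Proof.
elim: N => [|N IH]; first by rewrite big_geq// /remainder big_geq// subrr.
by rewrite big_nat_recr//= IH remainderS /weight; ring.
Qed.

Lemma remainder_eq0 N n x : v N x = 1 -> (N < n)%N -> remainder n x = 0.
Proof.
move=> vN; elim: n => // n IH; rewrite ltnS leq_eqVlt => /predU1P[<-|/IH H].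
  by rewrite remainderS vN subrr mulr0.
by rewrite remainderS H mul0r.
Qed.

Lemma remainder_lip n x y :
  `|remainder n x - remainder n y| <= (\sum_(0 <= j < n) L j) * `|x - y|.
Proof.
elim: n => [|n IH].
  by rewrite /remainder !big_geq// subrr normr0 mul0r.
rewrite !remainderS big_nat_recr//= mulrDl.
apply: le_trans (mul_unit_lip _ _ (remainder_01 n y) _) _.
  by have /andP[v0 v1] := bs_01 hb n x; rewrite subr_ge0 v1/= gerBl.
rewrite lerD//; have -> : 1 - v n x - (1 - v n y) = - (v n x - v n y) by ring.
by rewrite normrN (bs_lip hb).
Qed.

Lemma weight_lip n x y :
  `|weight n x - weight n y| <= (\sum_(0 <= j < n.+1) L j) * `|x - y|.
Proof.
apply: le_trans (mul_unit_lip _ _ (remainder_01 n y) (bs_01 hb n x)) _.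
by rewrite big_nat_recr//= mulrDl lerD// ?remainder_lip// (bs_lip hb).
Qed.

Lemma Ck_weight n : Ck k setT (weight n).
Proof.
apply: (Ck_scale (Y := R)); [exact: openT| |exact: (bs_Ck hb)].
apply: Ck_prod; first exact: openT.
move=> j; apply: Ck_add; [exact: openT|exact/Ck_cst/openT|].
by apply: Ck_opp; [exact: openT|exact: (bs_Ck hb)].
Qed.

Section patch.
Variables (Y : normedModType R) (h : nat -> X -> X -> Y).
Hypothesis r0 : forall s, Om s -> 0 < r s.
Hypothesis hCk : forall n s, Om s -> Ck k [set x | `|x - s| < r s] (h n s).

Let Z n x : Y := weight n x *: h n (c n x) x.

(** Discreteness leaves one centre [s] active near [x]. If [x] is outside the ball where [h n s] is
    smooth, it has a neighbourhood free of the support of the weight, which lies in the quarter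
    ball. *)
Lemma Ck_patch_term n : Ck k setT (Z n).
Proof.
apply: Ck_local; first exact: openT.
move=> x _; pose a : R := 2 ^- n; have a0 : 0 < a by rewrite invr_gt0 exprn_gt0.
have a4 : 0 < a / 4 by rewrite divr_gt0.
have [[y yx vy]|nv] := pselect (exists2 y, `|y - x| < a / 4 & v n y != 0); last first.
  exists (a / 4), (fun=> 0); split => //; first exact/Ck_cst/open_bN.
  move=> y yx; rewrite /Z (_ : weight n y = 0) ?scale0r//.
  by apply/eqP; apply: contraT => /weight_neq0 vy; exfalso; apply: nv; exists y.
have [Os _] := bs_center hb vy; set s := c n y in Os.
have near z : `|z - x| < a / 4 -> v n z != 0 -> c n z = s.
  move=> zx vz; apply: (bs_discrete hb vz vy); rewrite -/a.
  by have := ler_normD (z - x) (x - y); rewrite subrKA (distrC x y); lra.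
have [xs|xs] := ltP `|x - s| (r s).
  have [d d0 dP] := open_ballN (open_bN s (r s)) xs.
  exists (Num.min d (a / 4)), (fun z => weight n z *: h n s z); split.
  - by rewrite lt_min d0.
  - apply: Ck_scale; first exact: open_bN.
      exact: CkW (Ck_weight n).
    by apply: CkW (hCk n Os) => z /=; rewrite lt_min => /andP[/dP].
  - move=> z; rewrite lt_min => /andP[zd za]; rewrite /Z.
    have [->|/weight_neq0 vz] := eqVneq (weight n z) 0; first by rewrite !scale0r.
    by rewrite near.
exists (Num.min (r s / 2) (a / 4)), (fun=> 0); split.
- by rewrite lt_min a4 divr_gt0// r0.
- exact/Ck_cst/open_bN.
- move=> z; rewrite lt_min => /andP[zr za]; rewrite /Z.
  have [->|/weight_neq0 vz] := eqVneq (weight n z) 0; first by rewrite !scale0r.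
  have [_] := bs_center hb vz; rewrite near// => zs.
  exfalso; have := ler_normD (x - z) (z - s); rewrite subrKA (distrC x z).
  by have := r0 Os; lra.
Qed.

(** A series encoded as a finite sum, cut at some index with [v N x = 1], after which the terms
    vanish; without such an index the value is junk. *)
Definition patch x : Y := \sum_(0 <= n < (xget 0%N [set N | v N x = 1]).+1) Z n x.

Lemma patchE N K x : v N x = 1 -> (N < K)%N -> patch x = \sum_(0 <= n < K) Z n x.
Proof.
have H N1 K1 : v N1 x = 1 -> (N1 < K1)%N ->
    \sum_(0 <= n < K1) Z n x = \sum_(0 <= n < N1.+1) Z n x.
  move=> v1 N1K; rewrite (big_cat_nat _ (n := N1.+1))//= [X in _ + X]big_nat.
  rewrite [X in _ + X]big1 ?addr0// => n /andP[Nn _].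
  by rewrite /Z /weight (remainder_eq0 v1)// mul0r scale0r.
move=> vN NK; rewrite /patch; case: xgetP => [N1 _ /= v1|/(_ N)//].
by rewrite -(H N1 (maxn N1.+1 K))// ?leq_maxl// (H N)// ?leq_max ?NK ?orbT// -(H N K).
Qed.

Lemma Ck_patch : open Om -> Ck k Om patch.
Proof.
move=> oO; apply: Ck_local => // x /(bs_cover hb)[N [d d0 dP]].
exists d, (fun x => \sum_(0 <= n < N.+1) Z n x); split => //.
  by apply: Ck_sum => [|n]; [exact: open_bN|apply: CkW (Ck_patch_term n)].
by move=> y /dP /patchE; exact.
Qed.
End patch.
End weights.
End gluing.

Section smoothing.
Context {R : realType} {X Y : normedModType R} (k : option nat).
Hypotheses (hR : LA k X R) (hY : LA k X Y).

(* [f] is only controlled on [E], where on the ball of radius [r s] about [s] it is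
   the sum of the operator [T s] and of the [e s]-Lipschitz map [q s]; [m] is the
   prescribed precision. Only the values of [e] and [m] at centres whose balls
   meet the points under consideration enter the estimates for [g]. *)
Lemma smoothing : exists2 K : R, 0 <= K &
  forall (Om E : set X) (r e m : X -> R) (f : X -> Y) (q : X -> X -> Y)
    (T : X -> 'L(X; Y)), open Om -> E `<=` Om ->
  (forall s, Om s -> [/\ 0 < r s, 0 < e s & 0 < m s]) ->
  (forall s, Om s -> forall x y, `|x - s| < r s -> `|y - s| < r s ->
    `|q s x - q s y| <= e s * `|x - y|) ->
  (forall s x, Om s -> E x -> `|x - s| < r s -> f x = q s x + T s x) ->
  exists g : X -> Y, [/\ Ck k Om g,
    (forall x y M, E x -> E y ->
      (forall s, Om s -> `|x - s| < r s \/ `|y - s| < r s -> e s <= M) ->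
      `|(f x - g x) - (f y - g y)| <= K * M * `|x - y|) &
    (forall x M, E x -> (forall s, Om s -> `|x - s| < r s -> m s <= M) ->
      `|f x - g x| <= M)].
Proof.
have [C C0 HC] := LA_ball hY; exists (3 + C); first by rewrite addr_ge0.
move=> Om E r e m f q T oO EO rem0 qe fqT.
have r0 s : Om s -> 0 < r s by case/rem0.
have e0 s : Om s -> 0 < e s by case/rem0.
have m0 s : Om s -> 0 < m s by case/rem0.
have [v [c [L hb]]] := exists_bump_system hR r0.
(* The first part bounds the Lipschitz constant of [weight n]. The second makes [B n |x - y|] at
   least 1 for points too far apart to be forced to share a centre. *)
pose B n : R := \sum_(0 <= j < n.+1) L j + 2 * 2 ^+ n.
have p2 n : 0 < 2 ^- n :> R by rewrite invr_gt0 exprn_gt0.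
have p21 n : 2 ^- n <= 1 :> R by rewrite invf_le1 ?exprn_gt0// exprn_ege1// ler1n.
have B0 n : 0 < B n.
  rewrite ltr_wpDl ?mulr_gt0 ?exprn_gt0// sumr_ge0// => j _.
  exact: bs_ge0 hb j.
have BL n : \sum_(0 <= j < n.+1) L j <= B n.
  by rewrite lerDl mulr_ge0// exprn_ge0.
have B2 n : 1 <= B n * (2 ^- n / 2).
  rewrite mulrDl (_ : 2 * 2 ^+ n * _ = 1); last by field; rewrite expf_neq0.
  rewrite lerDr mulr_ge0 ?divr_ge0 ?(ltW (p2 n))// sumr_ge0// => j _.
  exact: bs_ge0 hb j.
have B1 n : 1 <= B n.
  by rewrite (le_trans (B2 n))// ler_piMr ?(ltW (B0 n))//; have := p21 n; lra.
(* Chosen so that [B n * eta n s] is at most 2^-n / 4 times [e s], which is summable over [n]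
   uniformly in [s]. *)
pose eta n s := Num.min (m s) (e s) * (2 ^- n / 4) / B n.
have eta0 n s : Om s -> 0 < eta n s.
  by move=> Os; rewrite divr_gt0// mulr_gt0 ?divr_gt0// lt_min m0// e0.
have /choice[w wP] : forall p : nat * X, exists w : X -> Y, Om p.2 ->
    [/\ Ck k [set x | `|x - p.2| < r p.2] w,
      (forall x y, `|x - p.2| < r p.2 -> `|y - p.2| < r p.2 ->
        `|w x - w y| <= C * e p.2 * `|x - y|) &
      (forall x, `|x - p.2| < r p.2 -> `|q p.2 x - w x| <= eta p.1 p.2)].
  move=> [n s]; have [Os|nO] := pselect (Om s); last by exists (fun=> 0).
  have [w] := HC s _ _ _ (q s) (r0 _ Os) (ltW (e0 _ Os)) (eta0 n _ Os) (qe _ Os).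
  by exists w.
(* The operator [T s] is smooth already; only [q s] is replaced, so the size of [T s] never enters
   the constants. *)
pose h n s x := w (n, s) x + T s x.
have hCk n s : Om s -> Ck k [set x | `|x - s| < r s] (h n s).
  move=> Os; have [wk _ _] := wP (n, s) Os.
  apply: Ck_add => //; [exact: open_bN|exact/Ck_lin/open_bN].
pose g := patch v c h; exists g.
pose D n x := f x - h n (c n x) x.
have act n x : weight v n x != 0 -> Om (c n x) /\ `|x - c n x| < r (c n x).
  move=> /weight_neq0 vx; have [Os xs] := bs_center hb vx; split => //.
  by have := r0 _ Os; lra.
have sumD x : E x -> exists N0, forall N, (N0 <= N)%N ->
    f x - g x = \sum_(0 <= n < N) weight v n x *: D n x.
  move=> /EO Ox; have [N0 [d d0 dP]] := bs_cover hb Ox; exists N0.+1 => N NN.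
  have vx : v N0 x = 1 by apply: dP; rewrite subrr normr0.
  rewrite /g (patchE c h vx NN) -[f x]scale1r.
  have -> : 1 = \sum_(0 <= n < N) weight v n x.
    by rewrite sum_weight (remainder_eq0 vx NN) subr0.
  rewrite scaler_suml -sumrB; apply: eq_bigr => n _.
  by rewrite -scalerBr.
have Dle n x : E x -> weight v n x != 0 -> `|D n x| <= eta n (c n x).
  move=> Ex /act[Os xs]; have [_ _ wq] := wP (n, c n x) Os.
  by rewrite /D (fqT _ _ Os Ex xs) /h opprD addrACA subrr addr0 wq.
have wge n x : 0 <= weight v n x by have /andP[] := weight_01 hb n x.
have wle n x : weight v n x <= 1 by have /andP[] := weight_01 hb n x.
have wsum N x : \sum_(0 <= n < N) weight v n x <= 1.
  by rewrite sum_weight lerBlDr lerDl; have /andP[] := remainder_01 hb N x.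
split.
- exact: (Ck_patch hb r0 hCk oO).
- move=> x y M Ex Ey eM.
  have M0 : 0 <= M.
    have := eM x (EO _ Ex); rewrite subrr normr0 => /(_ (or_introl (r0 _ (EO _ Ex)))).
    exact/le_trans/ltW/e0/EO.
  have etaM n s : Om s -> e s <= M -> B n * eta n s <= M * (2 ^- n / 4).
    move=> Os esM; rewrite /eta mulrC divfK ?gt_eqF// ler_wpM2r//.
    by rewrite ge_min esM orbT.
  (* Summation over [n] gives (1 + C) M from the weights and 2 M from the geometric series, hence
     the constant 3 + C. *)
  have key n : `|weight v n x *: D n x - weight v n y *: D n y| <=
      ((1 + C) * M * weight v n x + M * 2 ^- n) * `|x - y|.
    have pos : 0 <= (1 + C) * M * weight v n x.
      by rewrite mulr_ge0// mulr_ge0// addr_ge0.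
    have [[wx wy cxy]|ncxy] := pselect [/\ weight v n x != 0, weight v n y != 0 &
        c n x = c n y].
      have [Os xs] := act _ _ wx; have [_ ys] := act _ _ wy; rewrite -cxy in ys.
      have esM : e (c n x) <= M by apply: eM => //; left.
      have -> : weight v n x *: D n x - weight v n y *: D n y =
        weight v n x *: (D n x - D n y) + (weight v n x - weight v n y) *: D n y.
        by lmod R.
      rewrite (le_trans (ler_normD _ _))// (normrZ (weight v n x)).
      rewrite (normrZ (_ - _)) mulrDl lerD//.
        have -> : (1 + C) * M * weight v n x * `|x - y| =
          weight v n x * ((1 + C) * M * `|x - y|) by ring.
        rewrite (ger0_norm (wge n x)) ler_wpM2l//.
        have [_ wL _] := wP (n, c n x) Os.
        rewrite /D -cxy (fqT _ _ Os Ex xs) (fqT _ _ Os Ey ys) /h.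
        set a := q _ _; set a' := q _ _; set b := w _ _; set b' := w _ _.
        set t := T _ _; set t' := T _ _.
        have -> : a + t - (b + t) - (a' + t' - (b' + t')) = (a - a') - (b - b') by lmod R.
        rewrite (le_trans (ler_normB _ _))//.
        rewrite (le_trans (lerD (qe _ Os _ _ xs ys) (wL _ _ xs ys)))//.
        rewrite -mulrDl ler_wpM2r//= -[X in X + _]mul1r -mulrDl ler_wpM2l//.
        by rewrite addr_ge0.
      apply: (@le_trans _ _ (B n * `|x - y| * eta n (c n x))).
        rewrite ler_pM//; last by rewrite cxy; exact: Dle.
        by rewrite (le_trans (weight_lip hb n x y))// ler_wpM2r.
      rewrite mulrAC ler_wpM2r// (le_trans (etaM _ _ Os esM))// ler_wpM2l//.
      by rewrite ler_pdivrMr// ler_peMr ?(ltW (p2 n))// ler1n.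
    rewrite mulrDl; apply: ler_wpDl; first by rewrite mulr_ge0.
    (* Without a common bump the two terms are estimated separately. The weight is at most
       [B n |x - y|], either because it vanishes at the other point or because different centres are
       active. *)
    have half z z' : E z -> E z' -> `|z - z'| = `|x - y| ->
        (forall s, Om s -> `|z - s| < r s -> e s <= M) ->
        (weight v n z != 0 -> weight v n z' != 0 -> c n z <> c n z') ->
        `|weight v n z *: D n z| <= M * (2 ^- n / 4) * `|x - y|.
      move=> Ez Ez' zz eMz alt; rewrite normrZ (ger0_norm (wge n _)).
      have [->|wz] := eqVneq (weight v n z) 0.
        by rewrite mul0r !mulr_ge0// divr_ge0// ltW.
      have [Os zs] := act _ _ wz; have esM := eMz _ Os zs.
      have wB : weight v n z <= B n * `|x - y|.
        have [wz'|wz'] := eqVneq (weight v n z') 0.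
          have := weight_lip hb n z z'.
          rewrite wz' subr0 (ger0_norm (wge n z)) zz => /le_trans; apply.
          by rewrite ler_wpM2r.
        rewrite (le_trans (wle _ _))// (le_trans (B2 n))// ler_wpM2l ?(ltW (B0 n))//.
        rewrite -zz leNgt; apply/negP => zz'.
        exact/(alt wz wz')/(bs_discrete hb (weight_neq0 wz) (weight_neq0 wz') zz').
      rewrite (le_trans (ler_pM _ _ wB (Dle _ _ Ez wz)))//.
      by rewrite mulrAC ler_wpM2r// etaM.
    rewrite (le_trans (ler_normB _ _))//.
    apply: (@le_trans _ _ (M * (2 ^- n / 4) * `|x - y| + M * (2 ^- n / 4) * `|x - y|)).
      apply: lerD.
        apply: (half x y) => //; first by move=> s Os xs; apply: eM => //; left.
        by move=> wx wy cxy; apply: ncxy.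
      apply: (half y x) => //; first by rewrite distrC.
        by move=> s Os xs; apply: eM => //; right.
      by move=> wy wx cyx; apply: ncxy.
    rewrite -mulrDl ler_wpM2r// -mulrDr ler_wpM2l//.
    by have := p2 n; lra.
  have [N1 H1] := sumD _ Ex; have [N2 H2] := sumD _ Ey.
  rewrite (H1 (maxn N1 N2)) ?leq_maxl// (H2 (maxn N1 N2)) ?leq_maxr// -sumrB.
  rewrite (le_trans (ler_norm_sum _ _ _))// (le_trans (ler_sum _ (fun n _ => key n)))//.
  rewrite -mulr_suml ler_wpM2r// big_split/= -!mulr_sumr.
  have -> : (3 + C) * M = (1 + C) * M * 1 + M * 2 by ring.
  rewrite lerD// ler_wpM2l// ?sum_pow2_le// mulr_ge0// addr_ge0//.
- move=> x M Ex mM; have [N0 HN] := sumD _ Ex; rewrite (HN _ (leqnn _)).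
  have M0 : 0 <= M.
    have := mM x (EO _ Ex); rewrite subrr normr0 => /(_ (r0 _ (EO _ Ex))).
    exact/le_trans/ltW/m0/EO.
  rewrite (le_trans (ler_norm_sum _ _ _))//.
  rewrite -[leRHS]mul1r (le_trans _ (ler_wpM2r M0 (wsum N0 x)))// mulr_suml.
  apply: ler_sum => n _; rewrite normrZ (ger0_norm (wge n _)).
  have [->|wx] := eqVneq (weight v n x) 0; first by rewrite !mul0r.
  have [Os xs] := act _ _ wx.
  rewrite ler_wpM2l// (le_trans (Dle _ _ Ex wx))//.
  rewrite (le_trans _ (mM _ Os xs))// /eta.
  rewrite ler_pdivrMr//.
  have mm : Num.min (m (c n x)) (e (c n x)) <= m (c n x) by rewrite ge_min lexx.
  have mm0 : 0 <= Num.min (m (c n x)) (e (c n x)) by rewrite le_min !ltW ?m0 ?e0.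
  rewrite ler_pM// ?divr_ge0 ?(ltW (p2 n))//.
  by have := p21 n; have := B1 n; lra.
Qed.

End smoothing.

(** * The Whitney condition on the closure *)

Section whitney.
Context {R : realType}.

Lemma bo_sub (X Y : normedModType R) (L : 'L(X; Y)) x y : L (x - y) = L x - L y.
Proof. exact: linearB. Qed.

Lemma within_contN (X Y : normedModType R) (A : set X) (g : X -> Y) (x : X) (e : R) :
  {within A, continuous g} -> A x -> 0 < e ->
  exists2 d : R, 0 < d & forall y, A y -> `|y - x| < d -> `|g y - g x| < e.
Proof.
move=> /subspace_continuousP gc Ax e0.
have /cvgrPdist_lt/(_ e e0) := gc x Ax.
rewrite near_withinE => /nbhsNP[d d0 dP]; exists d => // y Ay yx.
by rewrite distrC; exact: dP.
Qed.

Lemma closureN (X : normedModType R) (A : set X) (a : X) (e : R) :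
  closure A a -> 0 < e -> exists2 x, A x & `|x - a| < e.
Proof.
move=> cAa e0; have [|x [Ax xa]] := cAa [set y | `|y - a| < e].
  by apply/nbhsNP; exists e.
by exists x.
Qed.

(** The partition with points t and 1 suffices. The bound keeps a short curve inside a small ball
    about its start. *)
Lemma curve_length_ge (X : normedModType R) (g : R -> X) (c : R) t :
  0 <= t <= 1 -> (curve_length 0 1 g <= c%:E)%E -> `|g t - g 0| <= c.
Proof.
move=> /andP[t0 t1] gc.
have H s : itv_partition 0 1 s -> polygon_length 0 1 g s <= c.
  move=> ps; rewrite -lee_fin (le_trans _ gc)//.
  by apply: ereal_sup_ubound; exists s.
have c0 : 0 <= c.
  apply: le_trans (H [:: 1] _); first by rewrite /polygon_length sumr_ge0.
  by split => //=; rewrite ltr01.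
move: t0; rewrite le_eqVlt => /predU1P[<-|t0]; first by rewrite subrr normr0.
move: t1; rewrite le_eqVlt => /predU1P[->|t1].
  have := H [:: 1]; rewrite /polygon_length/= big_nat1 /=; apply.
  by split => //=; rewrite ltr01.
apply: le_trans (H [:: t; 1] _); last by split => //=; rewrite t0 t1.
by rewrite /polygon_length/= big_nat_recl//= lerDl sumr_ge0.
Qed.

Variables (X : normedModType R) (Y : completeNormedModType R).
Variables (U : set X) (f : X -> Y) (G : X -> 'L(X; Y)).
Hypotheses (oU : open U) (hWQ : WQ U).
Hypotheses (hG : {within closure U, continuous G}).
Hypotheses (hfG : forall x, U x -> is_diff x f (G x)).

Lemma whitney_open (a : X) (e : R) : closure U a -> 0 < e ->
  exists2 d : R, 0 < d & forall x y, U x -> U y ->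
    `|x - a| < d -> `|y - a| < d -> `|f x - f y - G a (x - y)| <= e * `|x - y|.
Proof.
move=> cUa e0.
(* One [eta] comes from differentiability at [z], the other from continuity of [G] at [a]. *)
have loc eta : 0 < eta -> exists2 d1 : R, 0 < d1 &
    forall z, U z -> `|z - a| < d1 -> exists2 d : R, 0 < d & forall w,
      `|w - z| < d -> `|(f w - G a w) - (f z - G a z)| <= 2 * eta * `|w - z|.
  move=> eta0; have [d1 d10 d1P] := within_contN hG cUa eta0; exists d1 => // z Uz za.
  have Gz := d1P z (subset_closure Uz) za.
  have /is_diffP/(_ _ eta0)[d d0 dP] := hfG Uz; exists d => // w /dP H.
  have -> : f w - G a w - (f z - G a z) =
      (f w - f z - G z (w - z)) + (G z - G a) (w - z).
    by rewrite boBE !bo_sub; lmod R.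
  rewrite (le_trans (ler_normD _ _))// -mulrA mulrDl mul1r lerD// .
  rewrite (le_trans (opnorm_ub _ _))// ler_wpM2r// ltW//.
have GaE x y : f x - f y - G a (x - y) = (f x - G a x) - (f y - G a y).
  by rewrite bo_sub; lmod R.
have [Ua|nUa] := pselect (U a).
  have e2 : 0 < e / 2 by rewrite divr_gt0.
  have [d1 d10 d1P] := loc _ e2; have [d2 d20 d2P] := open_ballN oU Ua.
  exists (Num.min d1 d2); first by rewrite lt_min d10.
  move=> x y _ _ xa ya; rewrite GaE.
  apply: (@segment_lip R X Y (fun x => f x - G a x)) => t /andP[t0 t1].
  set z := y + t *: (x - y).
  have za : `|z - a| < Num.min d1 d2.
    have -> : z - a = (1 - t) *: (y - a) + t *: (x - a) by rewrite /z; lmod R.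
    rewrite (le_lt_trans (ler_normD _ _))// !normrZ.
    rewrite (ger0_norm t0) ger0_norm ?subr_ge0//.
    set A := `|y - a|; set B := `|x - a|; set m := Num.min d1 d2.
    have [AB|BA] := leP A B; last by rewrite (le_lt_trans _ ya)// -/A; nra.
    by rewrite (le_lt_trans _ xa)// -/B; nra.
  move: za; rewrite lt_min => /andP[za1 za2].
  have [d d0 dP] := d1P z (d2P _ za2) za1; exists d => // w /dP.
  by rewrite mulrCA divff ?mulr1.
have [|r [c [r0 c1 H]]] := hWQ (a := a).
  by split=> // /interior_subset.
have c0 : 0 < c by rewrite (lt_le_trans _ c1).
(* [loc] then gives local constant [e / c] along a curve of length at most [c |x - y|]. The radius
   [d1 / (1 + 2 c)] below keeps that curve in the [d1]-ball about [a]. *)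
have e2 : 0 < e / (2 * c) by rewrite divr_gt0// mulr_gt0.
have [d1 d10 d1P] := loc _ e2.
exists (Num.min r (d1 / (1 + 2 * c))).
  by rewrite lt_min r0 divr_gt0// addr_gt0// mulr_gt0.
move=> x y Ux Uy; rewrite !lt_min => /andP[xr xd] /andP[yr yd].
have [||g [gc gU [g0 g1] _ gl]] := H y x.
- by split => //; rewrite -ball_normE /= distrC.
- by split => //; rewrite -ball_normE /= distrC.
have pos : 0 < 1 + 2 * c by rewrite addr_gt0// mulr_gt0.
rewrite ltr_pdivlMr// in xd; rewrite ltr_pdivlMr// in yd.
have gin t : 0 <= t <= 1 -> `|g t - a| < d1.
  move=> t01; have := curve_length_ge t01 gl; rewrite g0 => gt.
  have := ler_normD (g t - y) (y - a); rewrite subrKA => h1.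
  have := ler_normD (y - a) (a - x); rewrite subrKA (distrC a x) => h2.
  have := normr_ge0 (y - a); have := normr_ge0 (x - a); have := normr_ge0 (y - x).
  by nra.
rewrite GaE -g0 -g1.
have [t t01|s ps us] := @path_lip R X Y (fun t => f (g t) - G a (g t)) g (e / c).
  have tI : t \in `[0, 1] by rewrite in_itv.
  have [d d0 dP] := d1P _ (gU t tI) (gin t t01).
  have [d' d'0 d'P] := within_contN gc tI d0.
  exists d' => // s s01 st; have -> : e / c = 2 * (e / (2 * c)) by field; rewrite gt_eqF.
  apply: dP; apply: d'P => //.
rewrite (le_trans us)//.
have : polygon_length 0 1 g s <= c * `|y - x|.
  by rewrite -lee_fin (le_trans _ gl)//; apply: ereal_sup_ubound; exists s.
move=> /(ler_wpM2l (ltW (divr_gt0 e0 c0))) /le_trans; apply.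
by rewrite g0 g1 mulrA divfK ?gt_eqF// distrC.
Qed.

(** Near [a] the map is Lipschitz on [U] with constant [|G a| + 1], so it is Cauchy along [U], and
    [Y] is complete. *)
Lemma limit_on_closure (a : X) : closure U a -> exists l : Y,
  forall e : R, 0 < e -> exists2 d : R, 0 < d &
    forall x, U x -> `|x - a| < d -> `|f x - l| < e.
Proof.
move=> cUa; have FF : ProperFilter (within U (nbhs a)) := within_nbhs_proper cUa.
have /cvg_ex[l fl] : cvg (f @ within U (nbhs a)).
  apply: cauchy_cvg; apply: cauchy_exP => e e0.
  have [d d0 dP] := whitney_open cUa ltr01.
  pose M := `|G a| + 1; have M0 : 0 < M by rewrite ltr_wpDl.
  pose d' := Num.min d (e / (2 * M)).
  have d'0 : 0 < d' by rewrite lt_min d0 divr_gt0// mulr_gt0.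
  have [x0 Ux0 xa] := closureN cUa d'0.
  exists (f x0); suff : \forall y \near a, U y -> ball (f x0) e (f y) by [].
  apply/nbhsNP.
  exists d' => // y ya Uy; rewrite -ball_normE /=.
  move: xa ya; rewrite !lt_min => /andP[xd xe] /andP[yd ye].
  have := dP _ _ Ux0 Uy xd yd; rewrite mul1r => H.
  rewrite -[f x0 - f y](subrK (G a (x0 - y))) (le_lt_trans (ler_normD _ _))//.
  rewrite (le_lt_trans (lerD H (opnorm_ub _ _)))//.
  have -> : `|x0 - y| + opnorm (G a) * `|x0 - y| = M * `|x0 - y|.
    by rewrite /M mulrDl mul1r addrC.
  rewrite -ltr_pdivlMl// mulrC.
  have := ler_normD (x0 - a) (a - y); rewrite subrKA (distrC a y) => h.
  rewrite (le_lt_trans h)//.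
  have -> : e / M = e / (2 * M) + e / (2 * M) by field; rewrite gt_eqF.
  by rewrite ltrD.
exists l => e e0; have /cvgrPdist_lt/(_ e e0) := fl.
rewrite near_withinE => /nbhsNP[d d0 dP]; exists d => // x Ux xa.
by rewrite distrC; exact: dP.
Qed.

Lemma whitney_closure : exists2 h : X -> Y, forall x, U x -> h x = f x &
  forall a, closure U a -> forall e : R, 0 < e -> exists2 d : R, 0 < d &
    forall x y, closure U x -> closure U y -> `|x - a| < d -> `|y - a| < d ->
      `|h x - h y - G a (x - y)| <= e * `|x - y|.
Proof.
have /choice[l lP] : forall a, exists l, closure U a ->
    forall e : R, 0 < e -> exists2 d : R, 0 < d &
    forall x, U x -> `|x - a| < d -> `|f x - l| < e.
  move=> a; have [/limit_on_closure[l lP]|na] := pselect (closure U a).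
    by exists l.
  by exists 0.
pose h x := if pselect (U x) then f x else l x.
have hl a : closure U a -> forall e : R, 0 < e -> exists2 x, U x &
    `|x - a| < e /\ `|f x - h a| < e.
  move=> ca e e0; rewrite /h; case: pselect => Ua.
    by exists a => //; rewrite !subrr !normr0.
  have [d d0 dP] := lP a ca e e0.
  have de : 0 < Num.min d e by rewrite lt_min d0.
  have [x Ux] := closureN ca de; rewrite lt_min => /andP[xd xe].
  by exists x => //; split => //; exact: dP.
exists h; first by move=> x Ux; rewrite /h; case: pselect.
move=> a ca e e0; have [d d0 dP] := whitney_open ca e0; exists d => // x y cx cy xa ya.
apply/ler_addgt0Pr => eps eps0.
(* Moving [x] and [y] into [U] by less than [t] changes the values by [2 t], the operator term by
   [2 |G a| t] and the right-hand side by [2 e t]. *)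
pose K := 2 + 2 * `|G a| + 2 * e.
have K0 : 0 < K by have := normr_ge0 (G a); rewrite /K; lra.
pose t := Num.min (eps / K) (Num.min (d - `|x - a|) (d - `|y - a|)).
have t0 : 0 < t by rewrite !lt_min divr_gt0//= !subr_gt0 xa ya.
have tK : K * t <= eps by rewrite mulrC -ler_pdivlMr// ge_min lexx.
have tx : t <= d - `|x - a| by rewrite !ge_min lexx orbT.
have ty : t <= d - `|y - a| by rewrite !ge_min lexx !orbT.
have [x' Ux' [xx fx]] := hl x cx t t0; have [y' Uy' [yy fy]] := hl y cy t t0.
have x'd : `|x' - a| < d by have := ler_normD (x' - x) (x - a); rewrite subrKA; lra.
have y'd : `|y' - a| < d by have := ler_normD (y' - y) (y - a); rewrite subrKA; lra.
have H := dP x' y' Ux' Uy' x'd y'd.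
have -> : h x - h y - G a (x - y) = (f x' - f y' - G a (x' - y'))
   - (f x' - h x) + (f y' - h y) + G a ((x' - x) - (y' - y)).
  by rewrite !bo_sub; lmod R.
have h3 := opnorm_ub (G a) (x' - x - (y' - y)).
have h4 := ler_normB (x' - x) (y' - y).
have h5 : `|x' - y'| <= `|x - y| + 2 * t.
  have -> : x' - y' = (x - y) + ((x' - x) - (y' - y)) by lmod R.
  by rewrite (le_trans (ler_normD _ _))// lerD2l; lra.
have h6 : opnorm (G a) * `|x' - x - (y' - y)| <= `|G a| * (2 * t).
  by rewrite ler_wpM2l ?opnorm_ge0//; lra.
rewrite (le_trans (ler_normD _ _))// (le_trans (lerD (ler_normD _ _) (lexx _)))//.
rewrite (le_trans (lerD (lerD (ler_normB _ _) (lexx _)) (lexx _)))//.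
have h7 : e * `|x' - y'| <= e * (`|x - y| + 2 * t) by rewrite ler_wpM2l// ltW.
rewrite /K in tK; lra.
Qed.

End whitney.

(** * Extensions of prescribed slope *)

Section slopes.
Context {R : realType} {X Y : normedModType R}.
Implicit Types (h g : X -> Y) (T : 'L(X; Y)) (x : X).

(** For all [e > 0] together this is strict differentiability of [h] at [x] with derivative [T]. For
    fixed [e] it also makes sense for merely Lipschitz maps. *)
Definition slope_near h x T (e : R) := exists2 d : R, 0 < d & forall y z,
  `|y - x| < d -> `|z - x| < d -> `|h y - h z - T (y - z)| <= e * `|y - z|.

Lemma slope_near_add h g x T S e e' : slope_near h x T e -> slope_near g x S e' ->
  slope_near (fun y => h y + g y) x (T + S) (e + e').
Proof.
move=> [d d0 dP] [c c0 cP]; exists (Num.min d c); first by rewrite lt_min d0.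
move=> y z; rewrite !lt_min => /andP[yd yc] /andP[zd zc].
have -> : h y + g y - (h z + g z) - (T + S) (y - z) =
  (h y - h z - T (y - z)) + (g y - g z - S (y - z)) by rewrite boDE; lmod R.
by rewrite (le_trans (ler_normD _ _))// mulrDl lerD// ?dP// cP.
Qed.

Lemma slope_near_change h x T S e e' : slope_near h x T e -> `|T - S| <= e' ->
  slope_near h x S (e + e').
Proof.
move=> [d d0 dP] TS; exists d => // y z yx zx.
have -> : h y - h z - S (y - z) = (h y - h z - T (y - z)) + (T - S) (y - z).
  by rewrite boBE; lmod R.
rewrite (le_trans (ler_normD _ _))// mulrDl lerD// ?dP//.
by rewrite (le_trans (opnorm_ub _ _))// ler_wpM2r.
Qed.

Lemma slope_near_le h x T e e' : e <= e' -> slope_near h x T e -> slope_near h x T e'.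
Proof.
move=> ee [d d0 dP]; exists d => // y z yx zx.
by rewrite (le_trans (dP _ _ yx zx))// ler_wpM2r.
Qed.

Lemma slope_near_lip h x e : (forall y z, `|h y - h z| <= e * `|y - z|) ->
  slope_near h x 0 e.
Proof. by move=> hl; exists 1 => // y z _ _; rewrite bo0E subr0. Qed.

Lemma slope_near_diff h x T (L : 'L(X; Y)) e : 0 <= e -> slope_near h x T e -> is_diff x h L ->
  `|L - T| <= e.
Proof.
move=> e0 [d d0 dP] /is_diffP hL; apply: bo_le => // v.
have [->|v0] := eqVneq v 0; first by rewrite linear0 !normr0 mulr0.
have v1 : 0 < `|v| by rewrite normr_gt0.
apply/ler_addgt0Pr => eps eps0.
have ev : 0 < eps / `|v| by rewrite divr_gt0.
have [c c0 cP] := hL _ ev.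
pose t := Num.min d c / (2 * `|v|).
have t0 : 0 < t by rewrite divr_gt0 ?mulr_gt0// lt_min d0.
have yx : `|x + t *: v - x| < Num.min d c.
  rewrite addrC addrA addNr add0r normrZ gtr0_norm//.
  have -> : t * `|v| = Num.min d c / 2 by rewrite /t; field; rewrite gt_eqF.
  by have : 0 < Num.min d c; [rewrite lt_min d0|lra].
move: yx; rewrite lt_min => /andP[yd yc].
have xx : `|x - x| < d by rewrite subrr normr0.
have := dP _ _ yd xx; have := cP _ yc.
have -> : x + t *: v - x = t *: v by lmod R.
set A := h _ - h x => h1 h2.
have : `|(L - T) (t *: v)| <= (e + eps / `|v|) * `|t *: v|.
  have -> : (L - T) (t *: v) = (A - T (t *: v)) - (A - L (t *: v)).
    by rewrite boBE; lmod R.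
  by rewrite (le_trans (ler_normB _ _))// mulrDl lerD.
have -> : (L - T) (t *: v) = t *: (L - T) v by rewrite linearZ.
rewrite !(normrZ t) (gtr0_norm t0) mulrCA ler_pM2l//.
by rewrite mulrDl divfK// gt_eqF.
Qed.

(** Mean value inequality for [h - D x] on segments in a small ball. *)
Lemma slope_near_C1 h (Om : set X) (D : X -> 'L(X; Y)) x e : open Om ->
  (forall y, Om y -> is_diff y h (D y)) -> Cn 0 Om D -> Om x -> 0 < e ->
  slope_near h x (D x) e.
Proof.
move=> oO hD /(Cn0P _ oO) Dc Ox e0; have e2 : 0 < e / 2 by rewrite divr_gt0.
have [d d0 dP] := Dc x Ox _ e2; have [c c0 cP] := open_ballN oO Ox.
exists (Num.min d c) => [|y z yx zx]; first by rewrite lt_min d0.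
have -> : h y - h z - D x (y - z) = (h y - D x y) - (h z - D x z).
  by rewrite bo_sub; lmod R.
apply: (@segment_lip R X Y (fun w => h w - D x w)) => t /andP[t0 t1].
set w := z + t *: (y - z).
have wx : `|w - x| < Num.min d c.
  have -> : w - x = (1 - t) *: (z - x) + t *: (y - x) by rewrite /w; lmod R.
  rewrite (le_lt_trans (ler_normD _ _))// !normrZ.
  rewrite (ger0_norm t0) ger0_norm ?subr_ge0//.
  set A := `|z - x|; set B := `|y - x|; set m := Num.min d c.
  have [AB|BA] := leP A B; last by rewrite (le_lt_trans _ zx)// -/A; nra.
  by rewrite (le_lt_trans _ yx)// -/B; nra.
move: wx; rewrite lt_min => /andP[/dP wd /cP Ow].
have /is_diffP/(_ _ e2)[b b0 bP] := hD _ Ow; exists b => // u /bP H.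
have -> : h u - D x u - (h w - D x w) =
    (h u - h w - D w (u - w)) + (D w - D x) (u - w).
  by rewrite boBE !bo_sub; lmod R.
rewrite (le_trans (ler_normD _ _))// [in leRHS](splitr e) mulrDl lerD//.
by rewrite (le_trans (opnorm_ub _ _))// ler_wpM2r// ltW.
Qed.

End slopes.

Section near_extension.
Context {R : realType} {X Y : normedModType R} (k : option nat).
Hypotheses (hk : k <> Some 0%N) (hR : LA k X R) (hY : LA k X Y) (hLE : LE X Y).
Variables (U : set X) (f : X -> Y) (G : X -> 'L(X; Y)).
Hypotheses (oU : open U) (hG : {within closure U, continuous G}).
Hypotheses (hfG : forall x, U x -> is_diff x f (G x)).
Hypothesis (hW : forall a, closure U a -> forall e : R, 0 < e ->
  exists2 d : R, 0 < d & forall x y, closure U x -> closure U y ->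
    `|x - a| < d -> `|y - a| < d -> `|f x - f y - G a (x - y)| <= e * `|x - y|).

(* The approximation error of [smoothing] is globally Lipschitz on [closure U],
   although [f] is only controlled locally: this is what makes (LE) applicable. *)
Lemma near_extension (e : R) : 0 < e -> exists p : X -> Y,
  [/\ (forall x, closure U x -> p x = f x),
      (forall b, closure U b -> slope_near p b (G b) e) &
      (forall x, exists T e', slope_near p x T e')].
Proof.
move=> e0; have [C C0 HC] := hLE; have [K K0 HK] := smoothing hR hY.
(* The slope error at [b] collects [e / 2] from [g], [C * ka] from the (LE)-extension [u] and [ka]
   from [|G b - D b|], hence the factor 1 + C. *)
pose e1 := e / (2 * (1 + C) * (K * C + 1)).
have KC0 : 0 <= K * C by rewrite mulr_ge0// ltW.
have C1 : 0 < 1 + C by rewrite addr_gt0.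
have KC1 : 0 < K * C + 1 by rewrite ltr_wpDl.
have e10 : 0 < e1 by rewrite !(divr_gt0, mulr_gt0).
pose ka := K * (C * e1).
have ka0 : 0 <= ka by rewrite mulr_ge0// mulr_ge0// ltW.
have kae : (1 + C) * ka <= e / 2.
  have -> : e / 2 = (1 + C) * (e1 * (K * C + 1)).
    by rewrite /e1; field; rewrite !gt_eqF.
  rewrite ler_wpM2l ?(ltW C1)// /ka mulrA [leRHS]mulrC ler_wpM2r ?(ltW e10)//.
  by rewrite lerDl.
have /choice[w wP] : forall s, exists w : R * (X -> Y) * 'L(X; Y),
    [/\ 0 < w.1.1, (forall x y, `|w.1.2 x - w.1.2 y| <= C * e1 * `|x - y|) &
      forall x, closure U x -> `|x - s| < w.1.1 -> f x = w.1.2 x + w.2 x].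
  move=> s; have [cs|ncs] := pselect (closure U s).
    have [d d0 dP] := hW cs e10.
    have [||q ql qE] := HC (closure U `&` [set x | `|x - s| < d]) e1
      (fun x => f x - G s x); first exact: ltW.
      move=> [x y] [[/= cx xs] [/= cy ys]].
      have -> : f x - G s x - (f y - G s y) = f x - f y - G s (x - y).
        by rewrite bo_sub; lmod R.
      exact: dP.
    exists (d, q, G s); split => //=; first by move=> x y; exact: (ql (x, y)).
    by move=> x cx xs; rewrite qE// subrK.
  (* Off the closure a ball missing it is used, where nothing is required of [f]. *)
  have [d d0 dP] : exists2 d : R, 0 < d & forall y, `|y - s| < d -> (~` closure U) y.
    by apply: open_ballN => //; apply: closed_openC; exact: closed_closure.
  exists (d, fun=> 0, 0); split => //=.
    by move=> x y; rewrite subrr normr0 mulr_ge0// mulr_ge0// ltW.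
  by move=> x cx /dP /(_ cx).
have [||||g [gk gl _]] := HK setT (closure U) (fun s => (w s).1.1) (fun=> C * e1)
    (fun=> 1) f (fun s => (w s).1.2) (fun s => (w s).2) openT.
- by [].
- by move=> s _; have [w0 _ _] := wP s; split => //; rewrite mulr_gt0.
- by move=> s _ x y _ _; have [_ + _] := wP s; exact.
- by move=> s x _ cx xs; have [_ _] := wP s; exact.
have fgl x y : closure U x -> closure U y ->
    `|(f x - g x) - (f y - g y)| <= ka * `|x - y|.
  by move=> cx cy; exact: gl.
have [D [gD Dc]] := Ck1 openT hk gk.
have [|u ul uE] := HC (closure U) ka (fun x => f x - g x) ka0.
  by move=> [x y] [/= cx cy]; exact: fgl.
have ul' x y : `|u x - u y| <= C * ka * `|x - y| by exact: (ul (x, y)).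
have gs x eta : 0 < eta -> slope_near g x (D x) eta.
  by move=> eta0; apply: (slope_near_C1 openT gD Dc).
(* On [U] the map [f - g] is locally [ka]-Lipschitz, so its derivative has norm at most [ka]; points
   of the boundary follow by continuity of [G] and [D]. *)
have DG b : closure U b -> `|G b - D b| <= ka.
  move=> cb.
  have DGU x : U x -> `|G x - D x| <= ka.
    move=> Ux; have s0 : slope_near (fun y => f y - g y) x 0 ka.
      have [d d0 dP] := open_ballN oU Ux; exists d => // y z /dP Uy /dP Uz.
      by rewrite bo0E subr0 fgl//; exact: subset_closure.
    have := slope_near_diff ka0 s0; rewrite -[X in `|X|]subr0; apply.
    have := is_diff_add (hfG Ux) (_ : is_diff x (fun y => - g y) (- D x)); apply.
    have /is_diffP gx := gD x Logic.I; apply/is_diffP => eta /gx[d d0 dP].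
    exists d => // y /dP; rewrite boNE.
    have -> : - g y - - g x - - D x (y - x) = - (g y - g x - D x (y - x)) by lmod R.
    by rewrite normrN.
  apply/ler_addgt0Pr => eta eta0; have eta2 : 0 < eta / 2 by rewrite divr_gt0.
  have [d1 d10 d1P] := within_contN hG cb eta2.
  have /(Cn0P _ openT)/(_ b Logic.I _ eta2)[d2 d20 d2P] := Dc.
  have [|x Ux] := @closureN _ _ _ _ (Num.min d1 d2) cb; first by rewrite lt_min d10.
  rewrite lt_min => /andP[x1 x2].
  have := d1P _ (subset_closure Ux) x1; have := d2P _ x2; have := DGU _ Ux.
  have -> : G b - D b = (G x - D x) - (G x - G b) + (D x - D b) by lmod R.
  move=> h1 h2 h3.
  have h4 := ler_normD (G x - D x - (G x - G b)) (D x - D b).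
  have h5 := ler_normB (G x - D x) (G x - G b).
  lra.
exists (fun x => g x + u x); split.
- by move=> x cx; rewrite uE// addrC subrK.
- move=> b cb; have e2 : 0 < e / 2 by rewrite divr_gt0.
  have s1 := slope_near_add (gs b _ e2) (slope_near_lip b ul').
  have := slope_near_change (S := G b) (e' := ka) s1; rewrite addr0 distrC => /(_ (DG _ cb)).
  by apply: slope_near_le; lra.
- move=> x; exists (D x + 0), (1 + C * ka).
  exact: slope_near_add (gs x _ ltr01) (slope_near_lip x ul').
Qed.

End near_extension.

(** * Interpolation off a closed set *)

Section interpolation.
Context {R : realType} {X Y : normedModType R}.
Variables (F : set X) (f : X -> Y) (G : X -> 'L(X; Y)).
Hypotheses (cF : closed F) (F0 : F !=set0).

Local Notation d := (dist F).

Lemma minmax_lip (r1 r2 d1 d2 r : R) : `|r1 - r2| <= r -> `|d1 - d2| <= r ->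
  `|Num.min (3 * d1) (Num.max r1 (2 * d1)) -
    Num.min (3 * d2) (Num.max r2 (2 * d2))| <= 3 * r.
Proof.
rewrite !ler_norml => /andP[a1 a2] /andP[b1 b2].
rewrite !minEle !maxEle.
by case: (leP r1); case: (leP r2) => h1 h2; case: ifP => h3; case: ifP => h4;
  move/negbT: h3 || idtac; move/negbT: h4 || idtac; rewrite -?ltNge;
  move=> *; apply/andP; split; lra.
Qed.

Lemma sum_pow2_tail (M K : nat) : (M <= K)%N ->
  \sum_(M <= n < K) 2 ^- n <= 2 * 2 ^- M :> R.
Proof.
move=> MK; have := sum_pow2 K (R := R); rewrite (big_cat_nat _ (n := M))//= sum_pow2.
have : 0 < 2 ^- K :> R by rewrite invr_gt0 exprn_gt0.
lra.
Qed.

Lemma finite_lower_bound (u : nat -> R) (M : nat) : (forall n, 0 < u n) ->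
  exists2 c : R, 0 < c & forall n, (n <= M)%N -> c <= u n.
Proof.
move=> u0; elim: M => [|M [c c0 cP]].
  by exists (u 0%N) => // n; rewrite leqn0 => /eqP ->.
exists (Num.min c (u M.+1)); first by rewrite lt_min c0 u0.
move=> n; rewrite leq_eqVlt => /predU1P[->|nM]; first by rewrite ge_min lexx orbT.
by rewrite ge_min cP.
Qed.

Section scale.
Variables (del : X -> R) (B : R).
Hypothesis delP : forall b, F b -> 0 < del b <= B.

(** Upper envelope of cones of slope 1 over the radii [del]. That it exceeds t >= 0 at [x] means
    that [x] lies at depth more than t in one of the balls [ball b (del b)]. *)
Definition scale (x : X) : R := sup [set Num.max 0 (del b - `|x - b|) | b in F].

Let scale_has_sup x : has_sup [set Num.max 0 (del b - `|x - b|) | b in F].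
Proof.
have [b0 Fb0] := F0; split; first by exists (Num.max 0 (del b0 - `|x - b0|)), b0.
exists B => _ [b Fb <-]; have /andP[h1 h2] := delP Fb.
rewrite ge_max (le_trans (ltW h1) h2)/=.
by have := normr_ge0 (x - b); lra.
Qed.

Lemma scale_ge x b : F b -> del b - `|x - b| <= scale x.
Proof.
move=> Fb; apply: (@le_trans _ _ (Num.max 0 (del b - `|x - b|))).
  by rewrite le_max lexx orbT.
by apply: (ub_le_sup (proj2 (scale_has_sup x))); exists b.
Qed.

Lemma scale_le x : scale x <= B.
Proof.
apply: ge_sup; first exact: (proj1 (scale_has_sup x)).
move=> _ [b Fb <-]; have /andP[h1 h2] := delP Fb.
rewrite ge_max (le_trans (ltW h1) h2)/=.
by have := normr_ge0 (x - b); lra.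
Qed.

Lemma scale_lip x y : `|scale x - scale y| <= `|x - y|.
Proof.
have H u w : scale u <= scale w + `|u - w|.
  apply: ge_sup; first exact: (proj1 (scale_has_sup u)).
  move=> _ [b Fb <-]; rewrite ge_max; apply/andP; split.
    rewrite addr_ge0//; apply: (@le_trans _ _ (Num.max 0 (del b - `|w - b|))).
      by rewrite le_max lexx.
    by apply: (ub_le_sup (proj2 (scale_has_sup w))); exists b.
  have := scale_ge w Fb; have := ler_normD (w - u) (u - b).
  by rewrite subrKA (distrC w u); lra.
by have := H x y; have := H y x; rewrite (distrC y x) ler_norml => *; apply/andP; split; lra.
Qed.

Lemma scale_gt x t : 0 <= t -> t < scale x -> exists2 b, F b & `|x - b| + t < del b.
Proof.
move=> t0 tx; have := sup_adherent (ltac:(rewrite subr_gt0; exact: tx) : 0 < scale x - t)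
  (scale_has_sup x).
move=> [_ [b Fb <-]]; rewrite -/(scale x) subKr lt_max ltNge t0/= => h.
by exists b => //; lra.
Qed.

(* Equals 0 where scale <= 2 d and 1 where scale >= 3 d; it has the junk value -2
   on [F]. *)
Definition cutoff x := Num.min (3 * d x) (Num.max (scale x) (2 * d x)) / d x - 2.

Lemma cutoff_eq0 x : ~ F x -> scale x <= 2 * d x -> cutoff x = 0.
Proof.
move=> nFx h; have d0 := dist_gt0 cF F0 nFx.
rewrite /cutoff (max_idPr h) (min_idPr _); last by rewrite ler_wpM2r ?(ltW d0)//; lra.
by rewrite mulfK ?gt_eqF// subrr.
Qed.

Lemma cutoff_eq1 x : ~ F x -> 3 * d x <= scale x -> cutoff x = 1.
Proof.
move=> nFx h; have d0 := dist_gt0 cF F0 nFx.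
rewrite /cutoff (min_idPl _); last by rewrite le_max h.
by rewrite mulfK ?gt_eqF//; ring.
Qed.

Lemma cutoff_num x : ~ F x ->
  2 * d x <= Num.min (3 * d x) (Num.max (scale x) (2 * d x)) <= 3 * d x.
Proof.
move=> nFx; have d0 := dist_gt0 cF F0 nFx.
rewrite ge_min lexx andbT le_min le_max lexx orbT andbT.
by rewrite ler_wpM2r ?(ltW d0)//; lra.
Qed.

Lemma cutoff_01 x : ~ F x -> 0 <= cutoff x <= 1.
Proof.
move=> nFx; have d0 := dist_gt0 cF F0 nFx; have /andP[h1 h2] := cutoff_num nFx.
rewrite /cutoff subr_ge0 ler_pdivlMr// h1/= lerBlDr ler_pdivrMr//; lra.
Qed.

(** The numerator is 3-Lipschitz and at most 3 d; division by d doubles the estimate. *)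
Lemma cutoff_lip x y : ~ F x -> ~ F y -> `|cutoff x - cutoff y| <= 6 / d x * `|x - y|.
Proof.
move=> nFx nFy; have dx := dist_gt0 cF F0 nFx; have dy := dist_gt0 cF F0 nFy.
have /andP[h1 h2] := cutoff_num nFy.
have := minmax_lip (scale_lip x y) (dist_lip x y F0).
rewrite /cutoff; move: h1 h2; set a := Num.min _ _; set b := Num.min _ _ => h1 h2 h3.
have -> : b / d x - 2 - (a / d y - 2) = ((b - a) * d y + a * (d y - d x)) / (d x * d y).
  by field; rewrite !gt_eqF.
rewrite normrM normfV [`|d x * d y|]gtr0_norm ?mulr_gt0//.
rewrite ler_pdivrMr ?mulr_gt0// (le_trans (ler_normD _ _))// !normrM.
have -> : 6 / d x * `|x - y| * (d x * d y) = 3 * `|x - y| * d y + 3 * d y * `|x - y|.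
  by field; rewrite gt_eqF.
rewrite (gtr0_norm dy) lerD ?ler_wpM2r ?(ltW dy)//.
have a0 : 0 <= a by rewrite (le_trans _ h1)// mulr_ge0// ltW.
rewrite (ger0_norm a0) ler_pM// distrC; exact: dist_lip.
Qed.
End scale.

Hypothesis near_ext : forall e : R, 0 < e -> exists p : X -> Y,
  [/\ (forall x, F x -> p x = f x),
      (forall b, F b -> slope_near p b (G b) e) &
      (forall x, exists T e', slope_near p x T e')].

Lemma interpolation : exists h : X -> Y,
  [/\ (forall b, F b -> forall e : R, 0 < e -> exists2 c : R, 0 < c &
        forall x, ~ F x -> `|x - b| < c -> slope_near h x (G b) e),
      (forall b, F b -> forall e : R, 0 < e -> exists2 c : R, 0 < c &
        forall x, ~ F x -> `|x - b| < c -> `|h x - f b - G b (x - b)| <= e * `|x - b|) &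
      (forall x, ~ F x -> exists T e', slope_near h x T e')].
Proof.
have p2 n : 0 < 2 ^- n :> R by rewrite invr_gt0 exprn_gt0.
have /choice[p pP] := fun n : nat => near_ext (p2 n).
have pF n x : F x -> p n x = f x by move=> Fx; have [->] := pP n.
(* The radius serves [p n] and [p n.+1] at once, so that their difference has Lipschitz constant 2 *
   2^-n on the ball. *)
have /choice[del delP] : forall nb : nat * X, exists r : R, F nb.2 ->
  [/\ 0 < r <= 2 ^- nb.1,
    (forall y z, `|y - nb.2| < r -> `|z - nb.2| < r ->
      `|p nb.1 y - p nb.1 z - G nb.2 (y - z)| <= 2 ^- nb.1 * `|y - z|) &
    (forall y z, `|y - nb.2| < r -> `|z - nb.2| < r ->
      `|p nb.1.+1 y - p nb.1.+1 z - G nb.2 (y - z)| <= 2 ^- nb.1 * `|y - z|)].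
  move=> [n b] /=; have [Fb|nFb] := pselect (F b); last by exists 0.
  have [_ /(_ b Fb)[c1 c10 c1P] _] := pP n.
  have [_ /(_ b Fb)[c2 c20 c2P] _] := pP n.+1.
  exists (Num.min (2 ^- n) (Num.min c1 c2)) => _.
  split.
  - by rewrite !lt_min p2 c10 c20 ge_min lexx.
  - by move=> y z; rewrite !lt_min => /and3P[_ y1 _] /and3P[_ z1 _]; exact: c1P.
  - move=> y z; rewrite !lt_min => /and3P[_ _ y1] /and3P[_ _ z1].
    rewrite (le_trans (c2P _ _ y1 z1))// ler_wpM2r//.
    by rewrite lef_pV2 ?posrE ?exprn_gt0// ler_weXn2l// ler1n.
pose dl n b := del (n, b).
have dlP n b : F b -> 0 < dl n b <= 2 ^- n by move=> Fb; have [] := delP (n, b) Fb.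
pose D n x := p n.+1 x - p n x.
have DF n x : F x -> D n x = 0 by move=> Fx; rewrite /D !pF// subrr.
have Dl n b y z : F b -> `|y - b| < dl n b -> `|z - b| < dl n b ->
    `|D n y - D n z| <= 2 * 2 ^- n * `|y - z|.
  move=> Fb yb zb; have [_ /(_ y z yb zb)/= h1 /(_ y z yb zb)/= h2] := delP (n, b) Fb.
  have -> : D n y - D n z = (p n.+1 y - p n.+1 z - G b (y - z)) -
     (p n y - p n z - G b (y - z)) by rewrite /D; lmod R.
  by rewrite (le_trans (ler_normB _ _))//; lra.
pose rho n := scale (dl n).
pose psi n := cutoff (dl n).
have psi01 n x : ~ F x -> 0 <= psi n x <= 1 by by move=> nFx; exact: cutoff_01.
(* Where the cutoff is nonzero, [x] has depth more than [2 d x] in a good ball. The ball then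
   contains points of [F] within [2 d x] of [x], and [D n] vanishes there. *)
have act n x : ~ F x -> psi n x != 0 -> exists2 b, F b & `|x - b| + 2 * d x < dl n b.
  move=> nFx; have d0 := dist_gt0 cF F0 nFx => px.
  apply: (scale_gt (dlP n)); first by rewrite mulr_ge0// ltW.
  by rewrite ltNge; apply: contraNN px => h; rewrite /psi cutoff_eq0.
have term_le n x : ~ F x -> `|psi n x *: D n x| <= 4 * 2 ^- n * d x.
  move=> nFx; have d0 := dist_gt0 cF F0 nFx.
  have [->|px] := eqVneq (psi n x) 0.
    by rewrite scale0r normr0 !mulr_ge0// ltW.
  have [b Fb xb] := act _ _ nFx px.
  have [|y Fy xy] := @dist_lt _ _ F x (2 * d x) F0; first by lra.
  have h1 : `|x - b| < dl n b by lra.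
  have h2 : `|y - b| < dl n b.
    by have := ler_normD (y - x) (x - b); rewrite subrKA (distrC y x); lra.
  have := Dl n b x y Fb h1 h2; rewrite (DF n y Fy) subr0 => h3.
  have /andP[q0 q1] := psi01 n x nFx.
  rewrite normrZ (ger0_norm q0) (@le_trans _ _ `|D n x|)// ?ler_piMl//.
  rewrite (le_trans h3)//; have := p2 n; nra.
(* 26 = 2 + 24: the Lipschitz constant of [D n], and the cutoff slope [6 / d] times the bound
   [4 * 2^-n * d] for [D n]. *)
have term_lip n x y : ~ F x -> ~ F y -> `|x - y| < 2 * d x -> `|x - y| < 2 * d y ->
    `|psi n x *: D n x - psi n y *: D n y| <= 26 * 2 ^- n * `|x - y|.
  have main u w : ~ F u -> ~ F w -> `|u - w| < 2 * d u -> psi n u != 0 ->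
      `|psi n u *: D n u - psi n w *: D n w| <= 26 * 2 ^- n * `|u - w|.
    move=> nFu nFw uw pu; have d0 := dist_gt0 cF F0 nFu.
    have [b Fb ub] := act _ _ nFu pu.
    have h1 : `|u - b| < dl n b by lra.
    have h2 : `|w - b| < dl n b.
      by have := ler_normD (w - u) (u - b); rewrite subrKA (distrC w u); lra.
    have h3 := Dl n b u w Fb h1 h2.
    have [|t Ft ut] := @dist_lt _ _ F u (2 * d u) F0; first by lra.
    have h4 : `|t - b| < dl n b.
      by have := ler_normD (t - u) (u - b); rewrite subrKA (distrC t u); lra.
    have := Dl n b u t Fb h1 h4; rewrite (DF n t Ft) subr0 => h5.
    have h6 : `|D n u| <= 4 * 2 ^- n * d u.
      by rewrite (le_trans h5)//; have := p2 n; nra.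
    have /andP[q0 q1] := psi01 n w nFw.
    have -> : psi n u *: D n u - psi n w *: D n w =
      psi n w *: (D n u - D n w) + (psi n u - psi n w) *: D n u by lmod R.
    rewrite (le_trans (ler_normD _ _))// !normrZ (ger0_norm q0).
    have h7 : `|psi n u - psi n w| * `|D n u| <= 6 / d u * `|u - w| * (4 * 2 ^- n * d u).
      by rewrite ler_pM// (cutoff_lip (dlP n)).
    have h8 : 6 / d u * `|u - w| * (4 * 2 ^- n * d u) = 24 * 2 ^- n * `|u - w|.
      by field; rewrite ?(gt_eqF d0) ?expf_neq0.
    have h9 : psi n w * `|D n u - D n w| <= `|D n u - D n w| by rewrite ler_piMl.
    lra.
  move=> nFx nFy xy1 xy2.
  have [px|px] := eqVneq (psi n x) 0; last exact: main.
  have [py|py] := eqVneq (psi n y) 0.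
    by rewrite px py !scale0r subrr normr0 !mulr_ge0// ltW.
  by rewrite distrC (distrC x y); apply: main => //; rewrite distrC.
have dlip x y : d x <= d y + `|x - y|.
  by have := dist_lip x y F0; rewrite ler_norml => /andP[_]; lra.
pose S K x := p 0%N x + \sum_(0 <= n < K) psi n x *: D n x.
have psi0 n K x : ~ F x -> 2 ^- K <= 2 * d x -> (K <= n)%N -> psi n x = 0.
  move=> nFx Kx Kn; apply: cutoff_eq0 => //.
  rewrite (le_trans (scale_le (dlP n) x))// (le_trans _ Kx)//.
  by rewrite lef_pV2 ?posrE ?exprn_gt0// ler_weXn2l// ler1n.
(* Since [scale] of index [n] is at most 2^-n, cutoffs with 2^-n <= 2 d vanish and the series is
   finite off [F]. *)
have SE K K' x : ~ F x -> 2 ^- K <= 2 * d x -> (K <= K')%N -> S K' x = S K x.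
  move=> nFx Kx KK; rewrite /S (big_cat_nat _ (n := K))//= [X in _ + (_ + X)]big_nat.
  rewrite [X in _ + (_ + X)]big1 ?addr0// => n /andP[Kn _].
  by rewrite (psi0 n K)// scale0r.
pose h x := S (xget 0%N [set K | 2 ^- K <= 2 * d x]) x.
have hE K x : ~ F x -> 2 ^- K <= 2 * d x -> h x = S K x.
  move=> nFx Kx; rewrite /h; case: xgetP => [K1 _ /= K1x|/(_ K)//].
  by rewrite -(SE K1 (maxn K K1))// ?leq_maxr// (SE K)// leq_maxl.
have sumlip M K x y : ~ F x -> ~ F y -> `|x - y| < 2 * d x -> `|x - y| < 2 * d y ->
    (M <= K)%N ->
    `|\sum_(M <= n < K) psi n x *: D n x - \sum_(M <= n < K) psi n y *: D n y| <=
    52 * 2 ^- M * `|x - y|.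
  move=> nFx nFy xy1 xy2 MK; rewrite -sumrB (le_trans (ler_norm_sum _ _ _))//.
  apply: (@le_trans _ _ (\sum_(M <= n < K) 26 * 2 ^- n * `|x - y|)).
    by apply: ler_sum => n _; exact: term_lip.
  rewrite -mulr_suml ler_wpM2r// -mulr_sumr.
  by have := sum_pow2_tail MK; lra.
(* For [n < M] one has scale >= 4 c - c >= 3 d, so those cutoffs are 1 and the sum telescopes from
   [p 0] to [p M]. *)
have split_sum M K b c x : F b -> (forall n, (n <= M)%N -> c <= dl n b / 4) ->
    ~ F x -> `|x - b| < c -> (M <= K)%N ->
    S K x = p M x + \sum_(M <= n < K) psi n x *: D n x.
  move=> Fb cP nFx xb MK; rewrite /S (big_cat_nat _ (n := M))//= addrA; congr (_ + _).
  have tel J : (J <= M)%N -> p 0%N x + \sum_(0 <= n < J) psi n x *: D n x = p J x.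
    elim: J => [_|J IH JM]; first by rewrite big_geq// addr0.
    rewrite big_nat_recr//= addrA IH ?(ltnW JM)//.
    have -> : psi J x = 1; last by rewrite scale1r /D addrC subrK.
    apply: cutoff_eq1 => //.
    have := scale_ge (dlP J) x Fb; have := cP J (ltnW JM); have := dist_le x Fb.
    lra.
  exact: tel.
have local x y : ~ F x -> `|y - x| < d x / 2 -> [/\ ~ F y & d x / 2 < d y].
  move=> nFx yx; have d0 := dist_gt0 cF F0 nFx.
  have dy : d x / 2 < d y by have := dlip x y; rewrite (distrC x y); lra.
  split => // Fy; have := dist_le y Fy; rewrite subrr normr0; lra.
exists h; split.
(* 53 = 1 + 52: the slope error of [p M] and the tail of the series, 26 times 2 * 2^-M. *)
- move=> b Fb e e0; have e53 : 0 < e / 53 by rewrite divr_gt0.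
  have [M Me] := pow2_small e53.
  have [c c0 cP] := finite_lower_bound M
    (fun n => ltac:(by have /andP[h0 _] := dlP n b Fb; rewrite divr_gt0) : 0 < dl n b / 4).
  exists (c / 2); first by rewrite divr_gt0.
  move=> x nFx xb; have d0 := dist_gt0 cF F0 nFx.
  have [K0 K0x] := pow2_small d0.
  (* Points close to [x] have distance more than [d x / 2] to [F], so one partial sum represents [h]
     at all of them. *)
  pose K := maxn M K0.
  have Kx : 2 ^- K < d x.
    rewrite (le_lt_trans _ K0x)// lef_pV2 ?posrE ?exprn_gt0// ler_weXn2l ?ler1n//.
    exact: leq_maxr.
  exists (Num.min (c / 2) (d x / 2)); first by rewrite lt_min !divr_gt0.
  move=> y z; rewrite !lt_min => /andP[yc yd] /andP[zc zd].
  have [nFy dy] := local _ _ nFx yd; have [nFz dz] := local _ _ nFx zd.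
  have yb : `|y - b| < c by have := ler_normD (y - x) (x - b); rewrite subrKA; lra.
  have zb : `|z - b| < c by have := ler_normD (z - x) (x - b); rewrite subrKA; lra.
  have yz : `|y - z| < d x.
    by have := ler_normD (y - x) (x - z); rewrite subrKA (distrC x z); lra.
  rewrite (hE K)//; last by lra.
  rewrite (hE K)//; last by lra.
  rewrite !(split_sum M K b c)// ?leq_maxl//.
  set s := \sum_(_ <= _ < _) _; set s' := \sum_(_ <= _ < _) _.
  have -> : p M y + s - (p M z + s') - G b (y - z) =
    (p M y - p M z - G b (y - z)) + (s - s') by lmod R.
  have cM : c <= dl M b.
    by have := cP M (leqnn _); have /andP[] := dlP M b Fb; lra.
  have [_ h1 _] := delP (M, b) Fb.
  have := h1 y z (lt_le_trans yb cM) (lt_le_trans zb cM) => /= h2.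
  have h3 : `|s - s'| <= 52 * 2 ^- M * `|y - z|.
    by apply: sumlip => //; [lra|lra|exact: leq_maxl].
  rewrite (le_trans (ler_normD _ _))// (le_trans (lerD h2 h3))// -mulrDl ler_wpM2r//.
  lra.
- move=> b Fb e e0; have e53 : 0 < e / 53 by rewrite divr_gt0.
  have [M Me] := pow2_small e53.
  have [c c0 cP] := finite_lower_bound M
    (fun n => ltac:(by have /andP[h0 _] := dlP n b Fb; rewrite divr_gt0) : 0 < dl n b / 4).
  exists c => // x nFx xb; have d0 := dist_gt0 cF F0 nFx.
  have [K0 K0x] := pow2_small d0.
  pose K := maxn M K0.
  have Kx : 2 ^- K < d x.
    rewrite (le_lt_trans _ K0x)// lef_pV2 ?posrE ?exprn_gt0// ler_weXn2l ?ler1n//.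
    exact: leq_maxr.
  rewrite (hE K)//; last by lra.
  rewrite (split_sum M K b c)// ?leq_maxl//.
  set s := \sum_(_ <= _ < _) _.
  have -> : p M x + s - f b - G b (x - b) = (p M x - p M b - G b (x - b)) + s.
    by rewrite (pF M b Fb); lmod R.
  have /andP[dM _] := dlP M b Fb.
  have cM : c <= dl M b by have := cP M (leqnn _); lra.
  have [_ h1 _] := delP (M, b) Fb.
  have bb : `|b - b| < dl M b by rewrite subrr normr0.
  have := h1 x b (lt_le_trans xb cM) bb => /= h2.
  have h3 : `|s| <= 8 * 2 ^- M * d x.
    rewrite (le_trans (ler_norm_sum _ _ _))//.
    apply: (@le_trans _ _ (\sum_(M <= n < K) 4 * 2 ^- n * d x)).
      by apply: ler_sum => n _; exact: term_le.
    rewrite -mulr_suml ler_wpM2r ?(ltW d0)// -mulr_sumr.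
    by have := sum_pow2_tail (leq_maxl M K0); rewrite -/K; lra.
  have h4 := dist_le x Fb.
  rewrite (le_trans (ler_normD _ _))// (le_trans (lerD h2 h3))//.
  apply: (@le_trans _ _ (9 * 2 ^- M * `|x - b|)); last first.
    by rewrite ler_wpM2r//; have := p2 M; lra.
  by have := p2 M; nra.
- move=> x nFx; have d0 := dist_gt0 cF F0 nFx.
  have [K Kx] := pow2_small d0.
  have [_ _ /(_ x)[T [e' [c c0 cP]]]] := pP 0%N.
  exists T, (e' + 52), (Num.min c (d x / 2)); first by rewrite lt_min c0 divr_gt0.
  move=> y z; rewrite !lt_min => /andP[yc yd] /andP[zc zd].
  have [nFy dy] := local _ _ nFx yd; have [nFz dz] := local _ _ nFx zd.
  have yz : `|y - z| < d x.
    by have := ler_normD (y - x) (x - z); rewrite subrKA (distrC x z); lra.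
  rewrite (hE K)//; last by lra.
  rewrite (hE K)//; last by lra.
  rewrite /S; set s := \sum_(_ <= _ < _) _; set s' := \sum_(_ <= _ < _) _.
  have -> : p 0%N y + s - (p 0%N z + s') - T (y - z) =
    (p 0%N y - p 0%N z - T (y - z)) + (s - s') by lmod R.
  have h3 : `|s - s'| <= 52 * 2 ^- 0 * `|y - z| by apply: sumlip => //; lra.
  rewrite (le_trans (ler_normD _ _))// (le_trans (lerD (cP _ _ yc zc) h3))//.
  by rewrite expr0 invr1 -mulrDl mulr1.
Qed.

End interpolation.

(** * The smooth extension *)

Section extension.
Context {R : realType} {X Y : normedModType R}.

Lemma slope_near_opp (h : X -> Y) x T e :
  slope_near h x T e -> slope_near (fun y => - h y) x (- T) e.
Proof.
move=> [d d0 dP]; exists d => // y z yx zx; rewrite boNE.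
have -> : - h y - - h z - - T (y - z) = - (h y - h z - T (y - z)) by lmod R.
by rewrite normrN dP.
Qed.

(* The infimum of the admissible slopes at [x] need not be attained, hence the
   slack [eps]. *)
Lemma near_best_slope (h : X -> Y) (eps : X -> R) :
  (forall x, 0 < eps x -> exists T e, slope_near h x T e) ->
  exists (T : X -> 'L(X; Y)) (e : X -> R), forall x, 0 < eps x ->
    [/\ 0 < e x, slope_near h x (T x) (e x) &
      forall S e', 0 <= e' -> slope_near h x S e' -> e x <= e' + eps x].
Proof.
move=> hs; pose I x := [set e : R | 0 <= e /\ exists T, slope_near h x T e].
have lbI x : has_lbound (I x) by exists 0 => e [].
have /choice[T TP] : forall x, exists T : 'L(X; Y), 0 < eps x ->
    slope_near h x T (inf (I x) + eps x).
  move=> x; have [e0|e0] := pselect (0 < eps x); last by exists 0.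
  have hI : has_inf (I x).
    split => //; have [T [e he]] := hs x e0; exists (Num.max 0 e).
    split; first by rewrite le_max lexx.
    by exists T; apply: slope_near_le he; rewrite le_max lexx orbT.
  have [e [_ [T he]] elt] := inf_adherent e0 hI.
  by exists T => _; apply: slope_near_le he; exact: ltW.
exists T, (fun x => inf (I x) + eps x) => x e0; split.
- rewrite ltr_wpDl//; have [T' [e he]] := hs x e0.
  apply: lb_le_inf; last by move=> ? [].
  exists (Num.max 0 e); split; first by rewrite le_max lexx.
  by exists T'; apply: slope_near_le he; rewrite le_max lexx orbT.
- exact: TP.
- by move=> S e' e'0 he; rewrite lerD2r; apply: ge_inf => //; split => //; exists S.
Qed.

Section smooth_extension.
Variables (k : option nat) (hk : k <> Some 0%N) (hR : LA k X R) (hY : LA k X Y).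
Variables (F : set X) (f h : X -> Y) (G : X -> 'L(X; Y)).
Hypotheses (cF : closed F) (F0 : F !=set0) (hG : {within F, continuous G}).
Hypothesis (hW : forall a, F a -> forall e : R, 0 < e ->
  exists2 d : R, 0 < d & forall x y, F x -> F y ->
    `|x - a| < d -> `|y - a| < d -> `|f x - f y - G a (x - y)| <= e * `|x - y|).
Hypotheses (hs : forall b, F b -> forall e : R, 0 < e -> exists2 c : R, 0 < c &
    forall x, ~ F x -> `|x - b| < c -> slope_near h x (G b) e)
  (hv : forall b, F b -> forall e : R, 0 < e -> exists2 c : R, 0 < c &
    forall x, ~ F x -> `|x - b| < c -> `|h x - f b - G b (x - b)| <= e * `|x - b|)
  (hl : forall x, ~ F x -> exists T e', slope_near h x T e').

Lemma smooth_extension : exists g : X -> Y,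
  [/\ forall x, F x -> g x = f x, Ck (Some 1%N) setT g & Ck k (~` F) g].
Proof.
have oO : open (~` F) by exact: closed_openC.
have dpos s : ~ F s -> 0 < dist F s by exact: dist_gt0.
have dzero s : 0 < dist F s -> ~ F s.
  by move=> + Fs; have := dist_le s Fs; rewrite subrr normr0 leNgt => /negP.
(* The slack [dist F] tends to 0 at [F], and its positivity singles out the points off [F]. *)
have [T [e TeP]] := near_best_slope (fun s ds => hl (dzero _ ds)).
have /choice[r rP] : forall s, exists r : R, ~ F s -> [/\ 0 < r, r <= dist F s / 2 &
    forall y z, `|y - s| < r -> `|z - s| < r ->
      `|h y - h z - T s (y - z)| <= e s * `|y - z|].
  move=> s; have [Fs|nFs] := pselect (F s); first by exists 0.
  have ds := dpos _ nFs; have [_ [c c0 cP] _] := TeP s ds.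
  exists (Num.min c (dist F s / 2)) => _; split.
  - by rewrite lt_min c0 divr_gt0.
  - by rewrite ge_min lexx orbT.
  - by move=> y z; rewrite !lt_min => /andP[yc _] /andP[zc _]; exact: cP.
have [K K0 HK] := smoothing hR hY.
have [||||g0 [gk gl gv]] := HK (~` F) (~` F) r e (fun s => dist F s ^+ 2) h
    (fun s x => h x - T s x) T oO.
- by [].
- move=> s nFs; have [r0 _ _] := rP s nFs; have [e0 _ _] := TeP s (dpos _ nFs).
  by split => //; rewrite exprn_gt0// dpos.
- move=> s nFs x y xs ys; have [_ _ sP] := rP s nFs.
  have -> : h x - T s x - (h y - T s y) = h x - h y - T s (x - y).
    by rewrite bo_sub; lmod R.
  exact: sP.
- by move=> s x _ _ _; rewrite subrK.
have [D [gD Dc]] := Ck1 oO hk gk.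
pose g x := if pselect (F x) then f x else g0 x.
pose Dg x := if pselect (F x) then G x else D x.
have gF x : F x -> g x = f x by rewrite /g; case: pselect.
have gnF x : ~ F x -> g x = g0 x by rewrite /g; case: pselect.
have DF x : F x -> Dg x = G x by rewrite /Dg; case: pselect.
have DnF x : ~ F x -> Dg x = D x by rewrite /Dg; case: pselect.
have close y s : ~ F s -> `|y - s| < r s ->
    dist F s <= 2 * dist F y /\ forall b, F b -> `|s - b| <= 2 * `|y - b|.
  move=> nFs ys; have [_ rs _] := rP s nFs; split.
    by have := dist_lip s y F0; rewrite ler_norml (distrC s y) => /andP[_]; lra.
  move=> b Fb; have := dist_le s Fb; have := ler_normD (s - y) (y - b).
  by rewrite subrKA (distrC s y); lra.
exists g; split.
- exact: gF.
- exists Dg; split.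
  + move=> x _; have [Fx|nFx] := pselect (F x); last first.
      rewrite DnF//; apply: is_diff_near (gD x nFx).
      have [d d0 dP] := open_ballN oO nFx.
      by apply/nbhsNP; exists d => // y /dP nFy; rewrite gnF.
    rewrite DF//; apply/is_diffP => eta eta0.
    have eta2 : 0 < eta / 2 by rewrite divr_gt0.
    have [d1 d10 d1P] := hW Fx eta0; have [d2 d20 d2P] := hv Fx eta2.
    (* The smoothing error is at most [(2 |y - x|)^2], which is at most [eta / 2 * |y - x|] within
       radius [eta / 8]. *)
    exists (Num.min d1 (Num.min d2 (eta / 8))); first by rewrite !lt_min d10 d20 divr_gt0.
    move=> y; rewrite !lt_min => /and3P[y1 y2 y3]; rewrite (gF x)//.
    have [Fy|nFy] := pselect (F y).
      by rewrite gF// d1P// subrr normr0.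
    rewrite gnF//.
    have -> : g0 y - f x - G x (y - x) = (h y - f x - G x (y - x)) - (h y - g0 y).
      by lmod R.
    rewrite (le_trans (ler_normB _ _))// [in leRHS](splitr eta) mulrDl lerD ?d2P//.
    apply: gv => // s nFs /(close _ _ nFs)[dsy _].
    have h1 := dist_le y Fx; have h2 := dist_ge0 F s.
    apply: (@le_trans _ _ ((2 * `|y - x|) ^+ 2)).
      by rewrite lerXn2r ?nnegrE ?mulr_ge0//; lra.
    have h3 := normr_ge0 (y - x); rewrite exprMn expr2; nra.
  + apply/(Cn0P _ openT) => x _ eta eta0.
    have [Fx|nFx] := pselect (F x); last first.
      have /(Cn0P _ oO)/(_ x nFx eta eta0)[d d0 dP] := Dc.
      have [c c0 cP] := open_ballN oO nFx.
      exists (Num.min d c); first by rewrite lt_min d0.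
      by move=> y; rewrite lt_min => /andP[/dP yd /cP nFy]; rewrite !DnF.
    have [d1 d10 d1P] := within_contN hG Fx eta0.
    (* [mu] is the slope error of [h] near [y] and [K * (2 * mu)] the Lipschitz constant of [h - g0]
       there; their sum is [eta / 2]. *)
    pose mu := eta / (2 * (1 + 2 * K)).
    have K1 : 0 < 1 + 2 * K by rewrite ltr_pwDl// mulr_ge0.
    have mu0 : 0 < mu by rewrite divr_gt0// mulr_gt0.
    have muE : mu + K * (2 * mu) < eta.
      have -> : mu + K * (2 * mu) = eta / 2 by rewrite /mu; field; rewrite gt_eqF.
      by lra.
    have [c c0 cP] := hs Fx mu0.
    exists (Num.min d1 (Num.min (c / 2) (mu / 2))).
      by rewrite !lt_min d10 !(divr_gt0 c0, divr_gt0 mu0).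
    move=> y; rewrite !lt_min => /and3P[y1 y2 y3]; rewrite (DF x)//.
    have [Fy|nFy] := pselect (F y); first by rewrite DF// d1P.
    rewrite DnF// (le_lt_trans _ muE)//.
    have hy : slope_near h y (G x) mu by apply: cP => //; lra.
    have [t t0 tP] := open_ballN oO nFy.
    have dy : slope_near (fun z => h z - g0 z) y 0 (K * (2 * mu)).
      exists (Num.min t (Num.min (c / 2 - `|y - x|) (mu / 2 - `|y - x|))).
        by rewrite !lt_min t0 !subr_gt0 y2.
      (* The slope [T s] was chosen without reference to [x]. Near-optimality compares it with
         [G x]: [e s <= mu + dist F s], and [dist F s <= |s - x| < mu]. *)
      have best z s : `|z - y| < Num.min t (Num.min (c / 2 - `|y - x|) (mu / 2 - `|y - x|)) ->
          ~ F s -> `|z - s| < r s -> e s <= 2 * mu.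
        rewrite !lt_min => /and3P[_ z2 z3] nFs zs.
        have [_ /(_ x Fx) sx] := close _ _ nFs zs.
        have zx := ler_normD (z - y) (y - x); rewrite subrKA in zx.
        have [_ _ /(_ (G x) mu (ltW mu0))] := TeP s (dpos _ nFs).
        have := dist_le s Fx => h1 h2.
        by have /h2 : slope_near h s (G x) mu by [apply: cP => //; lra]; lra.
      move=> z w zy wy; rewrite bo0E subr0; apply: gl.
      - by apply: tP; move: zy; rewrite lt_min => /andP[].
      - by apply: tP; move: wy; rewrite lt_min => /andP[].
      - by move=> s nFs [zs|ws]; [exact: (best z)|exact: (best w)].
    have := slope_near_add hy (slope_near_opp dy).
    rewrite (_ : (fun z => _) = g0); last by apply/funext => z; lmod R.
    rewrite oppr0 addr0 => sg; apply: slope_near_diff sg (gD y nFy).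
    by have := mulr_ge0 K0 (ltW mu0); lra.
- by apply: Ck_eq gk => // x nFx; exact: gnF.
Qed.

End smooth_extension.
End extension.

(** * Assembly of the extension *)

Theorem theorem49 (R : realType) (X : normedModType R)
  (Y : completeNormedModType R) (k : option nat) (hk : k <> Some 0%N)
  (hLE : LE X Y) (hLA : LA k X Y)
  (U : set X) (hU : open U) (hWQ : WQ U)
  (f : X -> Y) (hf : Ck (Some 1%N) U f)
  (G : X -> 'L(X; Y)) (hG : {within closure U, continuous G})
  (hfG : forall x, U x -> is_diff x f (G x)) :
  exists g : X -> Y,
    [/\ forall x, U x -> g x = f x,
        Ck (Some 1%N) setT g &
        Ck k (~` closure U) g].
Proof.
have oC : open (~` closure U) by apply: closed_openC; exact: closed_closure.
have [[u0 Uu0]|U0] := pselect (U !=set0); last first.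
  exists (fun=> 0); split; [|exact/Ck_cst/openT|exact: Ck_cst].
  by move=> x Ux; exfalso; apply: U0; exists x.
(* A nonzero vector of [Y] is what transfers (LA_k) to real values. *)
have [[y0 y00]|Y0] := pselect (exists y : Y, y != 0); last first.
  have Y0' (y : Y) : y = 0.
    by apply/eqP; apply: contrapT => /negP y0; apply: Y0; exists y.
  exists (fun=> 0); split; [|exact/Ck_cst/openT|exact: Ck_cst].
  by move=> x _; rewrite (Y0' (f x)).
have hR := LA_scalar y00 hLA.
(* [f] is constrained on [U] only; [f1] carries the limit values on the rest of the closure and
   replaces it from here on. *)
have [f1 f1U hW] := whitney_closure hU hWQ hG hfG.
have f1G x : U x -> is_diff x f1 (G x).
  move=> Ux; apply: is_diff_near (hfG x Ux).
  have [d d0 dP] := open_ballN hU Ux.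
  by apply/nbhsNP; exists d => // y /dP /f1U.
have cF : closed (closure U) by exact: closed_closure.
have F0 : closure U !=set0 by exists u0; exact: subset_closure.
have near_ext := near_extension hk hR hLA hLE hU hG f1G hW.
have [h [hs hv hl]] := interpolation cF F0 near_ext.
have [g [gF g1 gk]] := smooth_extension hk hR hLA cF F0 hG hW hs hv hl.
exists g; split => // x Ux; rewrite gF ?f1U//.
exact: subset_closure.
Qed.
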